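(* Let $K$ be an infinite compact space and let $\alpha$ be a countable ordinal. Then $$c(K^{(\alpha)},K)=\sup\Big\{|\Gamma| : C\big(K_{\Gamma,[1,\omega^{\alpha}]}\big)\text{ embeds isometrically into }C(K)\Big\}.$$
   Context: All compact spaces are Hausdorff. $C(K)$ is the real Banach space of continuous real-valued functions on $K$ with the supremum norm; isometric embeddings are linear. Cantor--Bendixson derivatives: $S^{(0)}=S$, $S^{(1)}$ is the set of accumulation points of $S$, $S^{(\beta+1)}=(S^{(\beta)})^{(1)}$, and $S^{(\alpha)}=\bigcap_{\beta<\alpha}S^{(\beta)}$ for limit $\alpha$. A cellular family in $S$ is a family of pairwise disjoint nonempty open subsets of $S$. For $A\subseteq S$, the relative cellularity $c(A,S)$ is the supremum of the cardinalities of cellular families $\mathcal U$ in $S$ such that $A\cap U\ne\emptyset$ for every $U\in\mathcal U$. $[1,\omega^\alpha]$ is the ordinal interval with the order topology (ordinal exponentiation). For a nonempty set $\Gamma$ and a nonempty compact space $L$, $K_{\Gamma,L}$ is the one-point compactification of the disjoint union of $|\Gamma|$ many copies of $L$ if $\Gamma$ is infinite, and simply the disjoint union of $|\Gamma|$ copies of $L$ if $\Gamma$ is finite. The supremum is over nonempty sets $\Gamma$, and the supremum of the empty set is $0$. *)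

(* Defs.v *)
From HB Require Import structures.
From mathcomp Require Import all_boot all_order all_algebra finmap.
From mathcomp Require Import all_classical all_reals all_analysis.

Set Implicit Arguments.
Unset Strict Implicit.
Unset Printing Implicit Defensive.

Import Order.TTheory GRing.Theory Num.Theory numFieldNormedType.Exports.

Local Open Scope classical_set_scope.
Local Open Scope card_scope.
Local Open Scope ring_scope.

(* An ordinal is represented by a well-ordered type A of that order type.  The
   ordinals beta <= alpha are then the elements of A together with a top
   element: Some a is the order type of {b | b < a}, None is alpha itself. *)
Definition withtop (T : Type) : Type := option T.

Section withtop_order.
Context {d : Order.disp_t} {T : orderType d}.
Implicit Types x y : withtop T.

HB.instance Definition _ := Choice.on (withtop T).

Definition withtop_lt x y : bool :=
  match x, y with
  | Some a, Some b => (a < b)%O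
  | Some _, None => true
  | None, _ => false
  end.

Let le x y := (x == y) || withtop_lt x y.
Let meet x y := if withtop_lt x y then x else y.
Let join x y := if withtop_lt x y then y else x.

Let lt_irr : irreflexive withtop_lt.
Proof. by case=> [a|] //=; rewrite ltxx. Qed.

Let lt_trans : transitive withtop_lt.
Proof. by case=> [b|] [a|] [c|] //=; exact: lt_trans. Qed.

Let lt_total x y : x != y -> withtop_lt x y || withtop_lt y x.
Proof. by case: x y => [a|] [b|] //= ab; rewrite -neq_lt; apply: contraNneq ab => ->. Qed.

HB.instance Definition _ := Order.LtOrder.Build d (withtop T)
  (le := le) (meet := meet) (join := join)
  (fun _ _ => erefl) (fun _ _ => erefl) (fun _ _ => erefl)
  lt_irr lt_trans lt_total.

End withtop_order.

Section ordinal_position.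
Context {d : Order.disp_t} {T : orderType d}.
Implicit Types a b c : T.

Definition is_zero a := forall b, ~ (b < a)%O.
Definition is_succ b a := (b < a)%O /\ forall c, (c < a)%O -> (c <= b)%O.
Definition is_limit a :=
  (exists b, (b < a)%O) /\
  forall b, (b < a)%O -> exists c, (b < c)%O /\ (c < a)%O.

End ordinal_position.

(* Accumulation points of the space E, hence points of E. *)
Definition derived_set {S : topologicalType} (E : set S) : set S :=
  E `&` limit_point E.

(* [cantor_bendixson beta] is S^(beta).  Transfinite recursion on the well-order
   is written as an inductive predicate; the expected equations are
   cantor_bendixson0, cantor_bendixsonS and cantor_bendixsonL. *)
Section cantor_bendixson.
Context {d : Order.disp_t} {T : orderType d} {S : topologicalType}.

Inductive cantor_bendixson : T -> set S :=
| CantorBendixson0 a x of is_zero a : cantor_bendixson a x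
| CantorBendixsonS b a x of is_succ b a & derived_set (cantor_bendixson b) x :
    cantor_bendixson a x
| CantorBendixsonL a x of is_limit a &
    (forall b, (b < a)%O -> cantor_bendixson b x) : cantor_bendixson a x.

Lemma cantor_bendixson0 a : is_zero a -> cantor_bendixson a = setT.
Proof. by move=> a0; apply/seteqP; split=> // x _; exact: CantorBendixson0. Qed.

Lemma cantor_bendixsonS b a : is_succ b a ->
  cantor_bendixson a = derived_set (cantor_bendixson b).
Proof.
move=> [ba bmax]; apply/seteqP; split=> x; last first.
  by move=> ?; exact: (@CantorBendixsonS b).
move=> Dx; case: Dx ba bmax => {a x} [a x a0|c a x [xa xmax] Dx|a x la _] ba bmax.
- by case: (a0 b).
- rewrite (_ : b = c)//.
  by apply/le_anti; rewrite bmax// xmax.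
- case: la => _ /(_ b ba)[c [bc ca]].
  by have := bmax c ca; rewrite leNgt bc.
Qed.

Lemma cantor_bendixsonL a : is_limit a ->
  cantor_bendixson a = \bigcap_(b in [set b | (b < a)%O]) cantor_bendixson b.
Proof.
move=> la; apply/seteqP; split=> x; last by move=> ?; exact: CantorBendixsonL.
move=> Dx; case: Dx la => {a x} [a x a0|b a x [ba bmax] _|a x _ Dx] la.
- by case: la => -[b /a0].
- by case: la => _ /(_ _ ba)[c [bc /bmax]]; rewrite leNgt bc.
- by move=> b; exact: Dx.
Qed.

End cantor_bendixson.

(* omega ^ alpha as the set of finitely supported functions alpha -> omega,
   compared at the largest argument where they differ; f stands for the Cantor
   normal form whose coefficient of omega ^ a is f a. *)
Definition omega_exp {d : Order.disp_t} (A : orderType d) : Type :=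
  {fsfun A -> nat with 0%N}.

Section omega_exp_order.
Context {d : Order.disp_t} {A : orderType d}.
Implicit Types f g : omega_exp A.

HB.instance Definition _ := Choice.on (omega_exp A).

Definition omega_exp0 : omega_exp A := [fsfun].

Definition omega_exp_lt f g : bool :=
  `[< exists a : A, (f a < g a)%N /\ forall b : A, (a < b)%O -> f b = g b >].

Let le f g := (f == g) || omega_exp_lt f g.
Let meet f g := if omega_exp_lt f g then f else g.
Let join f g := if omega_exp_lt f g then g else f.

Let lt_irr : irreflexive omega_exp_lt.
Proof. by move=> f; apply/asboolP => -[a []]; rewrite ltnn. Qed.

Let lt_trans : transitive omega_exp_lt.
Proof.
move=> g f h /asboolP[a [fga fgb]] /asboolP[b [ghb ghc]]; apply/asboolP.
case: (ltgtP a b) => [ab|ba|eab].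
- by exists b; split=> [|c bc]; [rewrite fgb|rewrite fgb ?ghc// (lt_trans ab)].
- by exists a; split=> [|c ac]; [rewrite -ghc|rewrite fgb ?ghc// (lt_trans ba)].
- rewrite -{}eab in ghb ghc; exists a; split=> [|c ac]; first exact: ltn_trans ghb.
  by rewrite fgb ?ghc.
Qed.

Let seq_max (s : seq A) : s != [::] ->
  exists2 m, m \in s & forall b, b \in s -> (b <= m)%O.
Proof.
elim: s => // x [_ _|y s /(_ isT)[m ms mmax] _].
  by exists x; rewrite ?mem_head// => b; rewrite inE => /eqP ->.
have [xm|mx] := leP x m.
  exists m => [|b]; first by rewrite inE ms orbT.
  by rewrite inE => /predU1P[->//|]; exact: mmax.
exists x => [|b]; first by rewrite mem_head.
by rewrite inE => /predU1P[->//|/mmax/le_trans]; apply; exact: ltW.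
Qed.

Let lt_total f g : f != g -> omega_exp_lt f g || omega_exp_lt g f.
Proof.
move=> fg; pose s := [seq a <- enum_fset (finsupp f `|` finsupp g)%fset | f a != g a].
have sP a : (a \in s) = (f a != g a).
  rewrite mem_filter; apply: andb_idr; apply: contraNT.
  by rewrite inE negb_or => /andP[/fsfun_dflt -> /fsfun_dflt ->].
have /seq_max[m] : s != [::].
  apply: contraNneq fg => s0; apply/eqP/fsfunP => a; apply/eqP.
  by have := sP a; rewrite s0 in_nil => /esym/negbFE.
rewrite sP neq_ltn => fgm mmax.
have eqfg b : (m < b)%O -> f b = g b.
  by move=> mb; apply/eqP; apply: contraTT mb; rewrite -sP -leNgt => /mmax.
by apply/orP; case/orP: fgm => ?; [left|right]; apply/asboolP; exists m;
  split=> // b /eqfg.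
Qed.

HB.instance Definition _ := Order.LtOrder.Build d (omega_exp A)
  (le := le) (meet := meet) (join := join)
  (fun _ _ => erefl) (fun _ _ => erefl) (fun _ _ => erefl)
  lt_irr lt_trans lt_total.

End omega_exp_order.

(* [1, omega ^ alpha]: the nonzero ordinals up to omega ^ alpha included. *)
Section ordinal_interval.
Context {d : Order.disp_t} (A : orderType d).

Record itv1_omega_exp : Type := Itv1OmegaExp {
  itv1_val : withtop (omega_exp A);
  itv1_gt0 : ((Some omega_exp0 : withtop (omega_exp A)) < itv1_val)%O
}.

HB.instance Definition _ := [isSub for itv1_val].
HB.instance Definition _ := [Choice of itv1_omega_exp by <:].
HB.instance Definition _ :=
  [SubChoice_isSubOrder of itv1_omega_exp by <: with d].

Definition ordinal_space : topologicalType := order_topology itv1_omega_exp.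

End ordinal_interval.

(* K_{Gamma,L}; the library's one-point compactification always adds a point. *)
Definition copies_space (Gamma : choiceType) (L : topologicalType) :
    topologicalType :=
  if `[< infinite_set [set: Gamma] >]
  then (one_point_compactification {_ : Gamma & L} : topologicalType)
  else ({_ : Gamma & L} : topologicalType).

(* The vector space C(K), as a subspace of the functions K -> R. *)
Section continuous_functions.
Context (R : realType) (K : topologicalType).

Definition continuous_pred : {pred (K -> R^o)} :=
  fun f => `[< continuous f >].

Lemma continuous_submod_closed : submod_closed continuous_pred.
Proof.
split=> [|a f g]; rewrite !unfold_in.
  by apply/asboolP => x; exact: cst_continuous.
move=> /asboolP cf /asboolP cg; apply/asboolP => x.
apply: cvgD; last exact: cg.
exact: cvgZl_tmp (cf x).
Qed.

HB.instance Definition _ :=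
  GRing.isSubmodClosed.Build R (K -> R^o) continuous_pred
    continuous_submod_closed.

Record Cfun : Type := CFun {
  Cfun_val :> K -> R^o;
  Cfun_continuous : Cfun_val \in continuous_pred
}.

HB.instance Definition _ := [isSub for Cfun_val].
HB.instance Definition _ := [Choice of Cfun by <:].
HB.instance Definition _ := [SubChoice_isSubLmodule of Cfun by <:].

Definition supnorm (f : Cfun) : R := sup [set `|f x| | x in [set: K]].

End continuous_functions.

Definition embeds_isometrically (R : realType) (K L : topologicalType) : Prop :=
  exists T : {linear Cfun R K -> Cfun R L},
    forall f : Cfun R K, supnorm (T f) = supnorm f.

(* |kappa| is the least cardinal above all the |F i| with P i. *)
Definition is_card_sup {I : Type} (P : I -> Prop) (F : I -> Type)
    (kappa : Type) : Prop :=
  (forall i, P i -> [set: F i] #<= [set: kappa]) /\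
  forall lambda : Type, (forall i, P i -> [set: F i] #<= [set: lambda]) ->
    [set: kappa] #<= [set: lambda].

Definition cellular_family {S : topologicalType} (U : set (set S)) : Prop :=
  (forall V, U V -> open V /\ V !=set0) /\ trivIset U id.

(* c(A, S) = |kappa| *)
Definition is_relative_cellularity {S : topologicalType} (A : set S)
    (kappa : Type) : Prop :=
  is_card_sup
    (fun U : set (set S) => cellular_family U /\ forall V, U V -> A `&` V !=set0)
    (fun U => set_type U) kappa.

(* Main.v *)
Require Import Defs.
From HB Require Import structures.
From mathcomp Require Import all_boot all_order all_algebra finmap.
From mathcomp Require Import all_classical all_reals all_analysis.
From mathcomp Require Import ring lra.
From Stdlib Require Wellfounded.Inverse_Image.

(* The two families whose suprema are compared realize the same cardinals.

   Let T embed C(K_{Gamma,L}) into C(K), with L = [1, omega^alpha].  For disjoint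
   clopen sets V, W one has |T 1_V| + |T 1_W| <= 1, so the peak sets
   {|T 1_V| = 1} are nonempty, increase with V and are disjoint for disjoint V.
   By compactness and induction on b, the peak set of an interval (s, p] of a copy
   of L meets K^(b) whenever the last exponent of the Cantor normal form of p is
   at least b.  Hence the open sets {|T 1_V| > 1/2}, V ranging over the copies of
   L, form a cellular family meeting K^(alpha).

   Conversely, let U be open and meet K^(alpha).  Enumerate L so that every p comes
   after the ordinal obtained from p by deleting its last power of omega.  Adding
   the points one at a time yields operators f |-> sum_(q in E) f(q) w_q: a new
   point p takes part of the weight of its successor t in E, near a point of
   K^(rank p) chosen close to a point of K^(rank t) where w_t = 1.  Composing
   a later operator with rounding up to E gives back the operator of E, so the
   operators converge uniformly on each continuous function, to an isometric
   operator from C(L) to C(K) with values supported in U.  The operators of a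
   cellular family are glued along the value at the point at infinity. *)

Set Implicit Arguments.
Unset Strict Implicit.
Unset Printing Implicit Defensive.

Import Order.TTheory GRing.Theory Num.Theory numFieldNormedType.Exports.

Local Open Scope classical_set_scope.
Local Open Scope card_scope.
Local Open Scope ring_scope.

(** * Suprema of cardinals *)

Section cardinals.

Lemma card_leTP (T U : Type) :
  [set: T] #<= [set: U] <-> exists f : T -> U, injective f.
Proof.
split=> [/card_leP[f]|[f finj]].
  exists (fun x => set_val (f (SigSub (in_setT x)))) => x y /val_inj xy.
  by have /(congr1 val) := @inj _ _ _ f _ _ (in_setT _) (in_setT _) xy.
have /injfunPex[g] : exists2 g : T -> U, set_fun [set: T] [set: U] g & set_inj [set: T] g.
  by exists f => // x y _ _; exact: finj.
exact: inj_card_le.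
Qed.

(* Hönig: a maximal set of sections, any two of which differ everywhere,
   projects onto one of the factors. *)
Lemma card_le_min (I X : Type) (A : I -> set X) (i : I) :
  exists j, forall k, A j #<= A k.
Proof.
pose P (D : set (I -> X)) := (forall phi, D phi -> forall k, A k (phi k)) /\
  (forall phi psi, D phi -> D psi -> forall k, phi k = psi k -> phi = psi).
have [|D [[DA Dinj] Dmax]] := @Zorn_bigcup _ P.
  move=> F FP Ftot; split=> [phi [D FD Dphi]|phi psi [D FD Dphi] [E FE Epsi]].
    by have [+ _] := FP _ FD; exact.
  have [DE|ED] := Ftot _ _ FD FE.
    by have [_] := FP _ FE; apply => //; exact: DE.
  by have [_] := FP _ FD; apply => //; exact: ED.
(* Otherwise each factor has a value missed by [D], and a section through such values enlarges
   [D]. *)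
have [j Dj] : exists j, A j `<=` [set phi j | phi in D].
  apply: contrapT => /forallNP noj.
  have /choice[phi phiP] k : exists a, A k a /\ ~ [set phi k | phi in D] a.
    by have /existsNP[a /not_implyP[Aa Da]] := noj k; exists a.
  apply: (Dmax (phi |` D)).
    split; first exact: subsetUr.
    move=> /(_ phi (or_introl erefl)) Dphi.
    by have [_] := phiP i; apply; exists phi.
  split=> [psi [->|/DA//] k|psi chi]; first by have [] := phiP k.
  move=> [->|Dpsi] [->|Dchi] k //; last exact: Dinj.
    by move=> e; have [_ []] := phiP k; exists chi.
  by move=> e; have [_ []] := phiP k; exists psi.
exists j => k.
(* A section of [D] is determined by its value in any one factor, so passing from the factor [j] to
   the factor [k] along sections is injective. *)
have /choice[s sP] a : exists phi, A j a -> D phi /\ phi j = a.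
  have [/Dj[phi Dphi <-]|nAa] := pselect (A j a); first by exists phi.
  by exists (fun=> a).
have /injfunPex[g] : exists2 g : X -> X, set_fun (A j) (A k) g & set_inj (A j) g.
  exists (fun a => s a k) => [a /sP[/DA]//|a b /set_mem/sP[Da ea] /set_mem/sP[Db eb] e].
  by rewrite -ea -eb (Dinj _ _ Da Db _ e).
exact: inj_card_le.
Qed.

(** The minimum principle is applied to the copies of [T] and [U] inside [T + U]. *)
Lemma card_le_total (T U : Type) :
  [set: T] #<= [set: U] \/ [set: U] #<= [set: T].
Proof.
pose A (b : bool) : set (T + U) := if b then range inl else range inr.
have cT : A true #= [set: T] by apply: inj_card_eq => x y _ _ [].
have cU : A false #= [set: U] by apply: inj_card_eq => x y _ _ [].
have [j Aj] := card_le_min A true.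
rewrite -(card_le_eql cT) -(card_le_eqr cU) -(card_le_eql cU) -(card_le_eqr cT).
by case: j Aj => Aj; [left|right].
Qed.

(** Among the subsets of [X] that bound the family there is a least one. For an arbitrary bound
    [lambda], either [X] embeds into it, or it can be copied into [X] and compared there. *)
Lemma card_sup_exists (I : Type) (P : I -> Prop) (F : I -> Type) (X : Type) :
  (forall i, P i -> [set: F i] #<= [set: X]) -> exists B : set X,
  is_card_sup P F (set_type B).
Proof.
move=> FX.
pose J := {B : set X | forall i, P i -> [set: F i] #<= B}.
have [[B BP] Bmin] := card_le_min (fun j : J => sval j) (exist _ [set: X] FX).
exists B; split=> [i Pi|lambda Flambda].
  by rewrite (card_le_eqr (card_setT B)); exact: (BP i Pi).
rewrite (card_le_eql (card_setT B)).
have [/card_leTP[f finj]|Xl] := card_le_total lambda X; last first.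
  exact: card_le_trans (card_leT B) Xl.
have cf : range f #= [set: lambda] by apply: inj_card_eq => x y _ _ /finj.
rewrite -(card_le_eqr cf).
have fP i : P i -> [set: F i] #<= range f.
  by move=> Pi; rewrite (card_le_eqr cf); exact: Flambda.
exact: (Bmin (exist _ _ fP)).
Qed.

End cardinals.

(** * Cantor normal forms *)

Section ordinals.
Context {d : Order.disp_t} {A : orderType d}.
Hypothesis A_wf : well_founded (fun a b : A => (a < b)%O).

Lemma wf_least (T : Type) (r : T -> T -> Prop) (P : T -> Prop) :
  well_founded r -> (exists x, P x) ->
  exists x, P x /\ forall y, r y x -> ~ P y.
Proof.
move=> rwf [x]; elim/(well_founded_ind rwf): x => x IH Px.
have [[y [yx Py]]|min] := pselect (exists y, r y x /\ P y); first exact: IH Py.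
by exists x; split=> // y yx Py; apply: min; exists y.
Qed.

Lemma withtop_wf : well_founded (fun a b : withtop A => (a < b)%O).
Proof.
have accS a : Acc (fun a b : withtop A => (a < b)%O) (Some a).
  elim/(well_founded_ind A_wf): a => a IH; constructor=> -[b ba|].
    exact: IH ba.
  by move=> /(lt_trans (isT : (Some a < None :> withtop A)%O)); rewrite ltxx.
case=> [a|]; first exact: accS.
by constructor=> -[b _|]; [exact: accS|rewrite ltxx].
Qed.

Lemma omega_ltP (f g : omega_exp A) : (f < g)%O <->
  exists a, (f a < g a)%N /\ forall b, (a < b)%O -> f b = g b.
Proof. by split=> [/asboolP//|fg]; apply/asboolP. Qed.

Lemma omega_expP (S : {fset A}) (h : A -> nat) :
  (forall x, x \notin S -> h x = 0%N) ->
  exists f : omega_exp A, forall x, f x = h x.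
Proof.
move=> hS; exists [fsfun x in S => h x] => x; rewrite fsfunE.
by case: ifPn => // /hS.
Qed.

Lemma omega_exp_max_supp (f : omega_exp A) (c : A) : f c <> 0%N ->
  exists m, f m <> 0%N /\ forall b, (m < b)%O -> f b = 0%N.
Proof.
move=> /eqP fc; have cf : c \in finsupp f by rewrite mem_finsupp.
case: (@arg_maxP _ _ _ [` cf]%fset xpredT (fun i : finsupp f => val i)) => // m _ mmax.
exists (val m); split; first by apply/eqP; rewrite -mem_finsupp; exact: valP.
move=> b mb; apply: fsfun_dflt; apply: contraTN mb => bf.
by rewrite -leNgt; exact: (mmax [` bf]%fset).
Qed.

(** Lexicographic induction: on a bound [c] for the support, then on the coefficient at [c], then on
    the remainder [low f], which is supported below [c]. *)
Lemma omega_exp_wf : well_founded (fun f g : omega_exp A => (f < g)%O).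
Proof.
pose acc := Acc (fun f g : omega_exp A => (f < g)%O).
have acc0 (f : omega_exp A) : ~ (exists b, f b <> 0%N) -> acc f.
  move=> f0; constructor=> g /omega_ltP[a [+ _]].
  by have -> : f a = 0%N by apply: contrapT => fa; apply: f0; exists a.
have acc_le (c : A) : forall f : omega_exp A, (forall b, (c < b)%O -> f b = 0%N) -> acc f.
  elim/(well_founded_ind A_wf): c => c IH.
  have accl (f : omega_exp A) : (forall b, (c <= b)%O -> f b = 0%N) -> acc f.
    move=> fc; have [[b fb]|f0] := pselect (exists b, f b <> 0%N); last first.
      exact: acc0 f0.
    have [m [fm mmax]] := omega_exp_max_supp fb.
    by apply: (IH m) => //; rewrite ltNge; apply/negP => /fc.
  suff accn n : forall f : omega_exp A, f c = n ->
      (forall b, (c < b)%O -> f b = 0%N) -> acc f.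
    by move=> f; exact: (accn (f c)).
  elim/ltn_ind: n => n IHn f fn f0.
  pose low (f : omega_exp A) : omega_exp A := [fsfun f with c |-> 0%N].
  have : acc (low f).
    apply: accl => b cb; rewrite /low fsfun_withE; case: eqVneq => // bc.
    by apply: f0; rewrite lt_neqAle eq_sym bc.
  move er : (low f) => r accr; elim: accr f fn f0 er => {}r _ IHr f fn f0 er.
  constructor=> g gf; have /omega_ltP[a [fga fgb]] := gf.
  have ac : (a <= c)%O.
    by rewrite leNgt; apply/negP => /f0 fa0; rewrite fa0 in fga.
  have g0 b : (c < b)%O -> g b = 0%N.
    by move=> cb; rewrite fgb ?f0//; exact: le_lt_trans ac cb.
  move: ac; rewrite le_eqVlt => /predU1P[eac|ac].
    by apply: (IHn (g c)) => //; rewrite -fn -eac.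
  apply: (IHr (low g)) => //; last by rewrite -fn fgb.
  rewrite -er; apply/omega_ltP; exists a; rewrite /low !fsfun_withE lt_eqF//.
  split=> // b ab; rewrite !fsfun_withE; case: eqP => // _; exact: fgb.
move=> f; have [[c /omega_exp_max_supp[m [_ fm]]]|f0] := pselect (exists b, f b <> 0%N).
  exact: acc_le fm.
exact: acc0 f0.
Qed.

Lemma omega_exp_countable : countable [set: A] -> countable [set: omega_exp A].
Proof.
move=> /countable_injP[e einj].
have {}einj : injective e by move=> x y; apply: einj; rewrite inE.
pose code (f : omega_exp A) := [seq (e a, f a) | a <- enum_fset (finsupp f)].
have codeP f a n : (0 < n)%N -> ((e a, n) \in code f) = (f a == n).
  move=> n0; apply/mapP/eqP => [[b bf [/einj -> ->]]//|fa].
  by exists a; rewrite ?fa// mem_finsupp fa -lt0n.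
apply/countable_injP; exists (choice.pickle \o code) => f g _ _ /= /(pcan_inj choice.pickleK) fg.
apply/fsfunP => a; have [fa|fa] := posnP (f a).
  have [->//|ga] := posnP (g a).
  by apply/eqP; rewrite -codeP// fg codeP.
by apply/esym/eqP; rewrite -codeP// -fg codeP.
Qed.

(** The exponent of the last term of the Cantor normal form, which is the Cantor-Bendixson rank of
    the point [p] of $[1,\omega^\alpha]$. The value [None] stands for $\alpha$, the rank of the top
    $\omega^\alpha$; it is also the default at zero. *)
Definition cnf_rank (p : withtop (omega_exp A)) : withtop A :=
  if p is Some f
  then xget None [set c | exists m, [/\ c = Some m, f m <> 0%N &
                                     forall b, (b < m)%O -> f b = 0%N]]
  else None.

Lemma cnf_rankP (f : omega_exp A) : (exists a, f a <> 0%N) ->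
  exists m, [/\ cnf_rank (Some f) = Some m, f m <> 0%N &
                forall b, (b < m)%O -> f b = 0%N].
Proof.
move=> /(wf_least A_wf)[m [fm mmin]]; rewrite /cnf_rank; case: xgetP => [c _ [m' [-> ? ?]]|].
  by exists m'.
move=> /(_ (Some m)); case; exists m; split=> // b /mmin; exact: contrapT.
Qed.

Lemma omega_exp_gt0 (f : omega_exp A) : (omega_exp0 < f)%O -> exists a, f a <> 0%N.
Proof.
move=> /omega_ltP[a [fa _]]; exists a => fa0; rewrite fa0 in fa.
by rewrite ltn0 in fa.
Qed.

Lemma omega_exp_ge0 (p : withtop (omega_exp A)) :
  ((Some omega_exp0 : withtop (omega_exp A)) <= p)%O.
Proof.
rewrite leNgt; case: p => [f|//]; apply/negP => /omega_ltP[a [+ _]].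
by rewrite fsfunE ltn0.
Qed.

(* For [p] with Cantor normal form ending in [omega ^ c], the witness is [p]
   with that last term removed. *)
Lemma cnf_rank_gap (p : withtop (omega_exp A)) :
  ((Some omega_exp0 : withtop (omega_exp A)) < p)%O ->
  exists s, (s < p)%O /\
    forall r, (s < r)%O -> (r < p)%O -> (cnf_rank r < cnf_rank p)%O.
Proof.
case: p => [f|_]; last first.
  exists (Some omega_exp0); split=> // -[g|//] g0 _.
  by have [m [-> _ _]] := cnf_rankP (omega_exp_gt0 g0).
move=> /omega_exp_gt0/cnf_rankP[m [-> /eqP fm fm0]].
pose s : omega_exp A := [fsfun f with m |-> (f m).-1].
have sE x : s x = if x == m then (f m).-1 else f x by rewrite /s fsfun_withE.
have sm x : (m < x)%O -> s x = f x by move=> mx; rewrite sE gt_eqF.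
exists (Some s); split.
  apply/omega_ltP; exists m; rewrite sE eqxx; split; last exact: sm.
  by rewrite prednK// lt0n.
move=> [g|//] /omega_ltP[a' [sga sgb]] /omega_ltP[a [gfa gfb]].
have [|m' [-> /eqP gm' gm0]] := @cnf_rankP g.
  by exists a' => ga; rewrite ga in sga.
change (m' < m)%O; rewrite ltNge; apply/negP => mm'.
(* If [m <= m'], then [g] differs from [f] and from [s] at places [a] and [a'] not below [m]. But
   [s] and [f] agree above [m] and differ by one at [m], which leaves no room for [g]. *)
have ma : (m <= a)%O by rewrite leNgt; apply/negP => /fm0 fa; rewrite fa in gfa.
have ma' : (m <= a')%O.
  rewrite leNgt; apply/negP => a'm.
  by have ga := gm0 _ (lt_le_trans a'm mm'); rewrite ga in sga.
case: (ltgtP a a') => aa'.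
- by move: sga; rewrite sm ?(le_lt_trans ma aa')// -gfb// ltnn.
- move: gfa; rewrite -sgb// sm ?ltnn//; exact: le_lt_trans aa'.
- move: gfa sga; rewrite -aa'; move: ma; rewrite le_eqVlt => /predU1P[<-|ma].
    by rewrite sE eqxx; case: (f m) => [//|n] /=; rewrite ltnS leqNgt => /negP.
  by rewrite sm// => /ltnW; rewrite leqNgt => /negP.
Qed.

(* The witness rounds [s] up to a multiple of [omega ^ b]. *)
Lemma cnf_rank_dense (b : withtop A) (s p : withtop (omega_exp A)) :
  (s < p)%O -> (b < cnf_rank p)%O ->
  exists q, [/\ (s < q)%O, (q < p)%O & (b <= cnf_rank q)%O].
Proof.
case: b => [b|//]; case: s => [g|//] gp bp.
have [|q qE] := @omega_expP (b |` finsupp g)%fset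
    (fun x => if (x < b)%O then 0 else if x == b then (g b).+1 else g x)%N.
  move=> x; rewrite !inE negb_or => /andP[/negPf -> /fsfun_dflt ->].
  by case: ifP.
have qb : q b = (g b).+1 by rewrite qE ltxx eqxx.
exists (Some q); split.
- apply/omega_ltP; exists b; rewrite qb; split=> // x bx.
  by rewrite qE ltNge (ltW bx) /= gt_eqF.
- case: p gp bp => [f|//] /omega_ltP[a [gfa gfb]].
  have [|m [-> _ m0]] := @cnf_rankP f; first by exists a => fa; rewrite fa in gfa.
  move=> bm; have {}bm : (b < m)%O := bm.
  (* Since [f a] is nonzero, [a] is at least the last exponent [m]; so the increment at [b] happens
     below the place where [f] exceeds [g]. *)
  have ba : (b < a)%O.
    apply: lt_le_trans bm _; rewrite leNgt; apply/negP => /m0 fa.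
    by rewrite fa in gfa.
  apply/omega_ltP; exists a; rewrite qE ltNge (ltW ba) /= gt_eqF//.
  split=> // x ax; rewrite qE ltNge (ltW (lt_trans ba ax)) /= gt_eqF ?gfb//.
  exact: lt_trans ax.
- have [|m [-> qm _]] := @cnf_rankP q; first by exists b; rewrite qb.
  rewrite leNgt; apply/negP => mb; apply: qm; rewrite qE.
  by rewrite (mb : (m < b)%O).
Qed.

End ordinals.

(** * The interval [1, omega ^ alpha] *)

Section ordinal_topology.
Context {d : Order.disp_t} {A : orderType d}.
Hypothesis A_wf : well_founded (fun a b : A => (a < b)%O).
Local Notation W := (withtop (omega_exp A)).
Local Notation L := (ordinal_space A).
Local Notation ord := (fun x : L => itv1_val x : W).
Local Notation zero := (Some omega_exp0 : W).

Lemma omega_exp_withtop_wf : well_founded (fun s t : W => (s < t)%O).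
Proof. exact/withtop_wf/omega_exp_wf. Qed.

Definition ordinal_max : L := @Itv1OmegaExp _ A None isT.

Definition oc_itv (s t : W) : set L := [set q | (s < ord q)%O && (ord q <= t)%O].

Lemma ord_le (p q : L) : (p <= q)%O = (ord p <= ord q)%O.
Proof. by []. Qed.

Lemma ord_lt (p q : L) : (p < q)%O = (ord p < ord q)%O.
Proof. by rewrite !lt_neqAle ord_le. Qed.

Lemma ordinal_nbhs_gt (s : W) (q : L) : (s < ord q)%O ->
  nbhs q [set r : L | (s < ord r)%O].
Proof.
move=> sq; have [s0|s0] := eqVneq s zero.
  by apply: filterE => r /=; rewrite s0; exact: itv1_gt0.
have s_gt0 : (zero < s)%O by rewrite lt_neqAle eq_sym s0 omega_exp_ge0.
pose a : L := Itv1OmegaExp s_gt0.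
have qa : (`]a, +oo[%classic : set L) q by rewrite /= in_itv /= andbT ord_lt.
apply: filterS (open_nbhs_nbhs (conj (rray_open a) qa)) => r /=.
by rewrite in_itv /= andbT ord_lt.
Qed.

(** This set is the open ray below the successor of [q], or everything if [q] is the greatest
    point. *)
Lemma ordinal_nbhs_le (q : L) : nbhs q [set r : L | (ord r <= ord q)%O].
Proof.
have [[b qb]|qmax] := pselect (exists b : L, (q < b)%O); last first.
  by apply: filterE => r /=; rewrite leNgt -ord_lt; apply/negP => ?; apply: qmax; exists r.
have [c [qc cmin]] : exists c : L, (q < c)%O /\ forall r, (r < c)%O -> ~ (q < r)%O.
  apply: (wf_least _ (ex_intro _ b qb)).
  exact: (Stdlib.Wellfounded.Inverse_Image.wf_inverse_image _ _ _ _ omega_exp_withtop_wf).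
have cq : (`]-oo, c[%classic : set L) q by rewrite /= in_itv.
apply: filterS (open_nbhs_nbhs (conj (lray_open c) cq)) => r /=.
by rewrite in_itv /= => /cmin /negP; rewrite -leNgt.
Qed.

Lemma ordinal_nbhsP (q : L) (U : set L) :
  nbhs q U <-> exists s, (s < ord q)%O /\ oc_itv s (ord q) `<=` U.
Proof.
split=> [|[s [sq sU]]]; last first.
  apply: filterS sU _.
  apply: filterS2 (ordinal_nbhs_gt sq) (ordinal_nbhs_le q) => r /= sr rq.
  by rewrite /oc_itv /= sr.
rewrite order_nbhs_itv => -[[l u] [iopen]].
rewrite itv_boundlr => /andP[lq qu] lU.
have [s [sq sl]] : exists s, (s < ord q)%O /\
    forall r : L, (s < ord r)%O -> (l <= BLeft r)%O.
  case: l iopen lq {lU} => [b a|[|]] //; last by move=> *; exists zero; split=> //; exact: itv1_gt0.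
  move=> /itv_open_ends_lside ->; rewrite bnd_simp ord_lt => aq.
  by exists (ord a); split=> // r ar; rewrite bnd_simp ord_lt.
exists s; split=> // r /andP[sr rq]; apply: lU => /=.
rewrite itv_boundlr; apply/andP; split; first exact: sl.
by apply: le_trans qu; rewrite bnd_simp.
Qed.

Lemma oc_itv_open (s t : W) : open (oc_itv s t).
Proof.
rewrite openE => q /andP[sq qt]; apply/ordinal_nbhsP; exists s; split=> //.
by move=> r /andP[sr rq]; rewrite /oc_itv /= sr (le_trans rq).
Qed.

Lemma oc_itv_closed (s t : W) : closed (oc_itv s t).
Proof.
rewrite -openC openE => q qst; apply/ordinal_nbhsP.
have [sq|qs] := ltP s (ord q).
  have tq : (t < ord q)%O.
    by rewrite ltNge; apply/negP => qt; apply: qst; rewrite /oc_itv /= sq.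
  exists t; split=> // r /andP[tr rq] /andP[_].
  by rewrite leNgt tr.
exists zero; split; first exact: itv1_gt0.
by move=> r /andP[_ rq] /andP[]; rewrite ltNge (le_trans rq qs).
Qed.

(** Induction along the order, in near-covering form: a neighborhood of the point [t] contains an
    interval [(s, t]], and the points up to [s] fall under the induction hypothesis. *)
Lemma ordinal_compact : compact [set: L].
Proof.
apply/compact_near_coveringP => J F P FF FP.
suff le_near (t : W) : \near F, forall q : L, (ord q <= t)%O -> P F q.
  by near=> i => q _; apply: (near (le_near None)) => //; rewrite leNgt; case: (ord q).
elim/(well_founded_ind omega_exp_withtop_wf): t => t IH.
have [[q qt]|tN] := pselect (exists q : L, ord q = t); last first.
  have t0 : t = zero.
    apply/eqP; rewrite eq_le omega_exp_ge0 andbT leNgt; apply/negP => t0.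
    by apply: tN; exists (Itv1OmegaExp t0).
  by apply: filterE => i q; rewrite t0 leNgt itv1_gt0.
have [[U V] [/= /ordinal_nbhsP[s [sq sU]] FV] UV] := FP q I.
rewrite qt in sq.
near=> i => r rt; have [sr|rs] := ltP s (ord r); last exact: (near (IH s sq)).
apply: (UV (r, i)); split => /=; last exact: (near FV).
by apply: sU; rewrite /oc_itv /= sr qt.
Unshelve. all: by end_near.
Qed.

End ordinal_topology.

(** * Rounding up to a finite set of points *)

Section rounding.
Context {d : Order.disp_t} {T : orderType d}.
Hypothesis T_wf : well_founded (fun s t : T => (s < t)%O).
Implicit Types (E : seq T) (p t : T).

Definition is_least_above E p t :=
  [/\ t \in E, (p <= t)%O & forall e, e \in E -> (p <= e)%O -> (t <= e)%O].

Definition least_above E p := xget p (is_least_above E p).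

Lemma least_aboveP E p : (exists2 m, m \in E & (p <= m)%O) ->
  is_least_above E p (least_above E p).
Proof.
move=> [m mE pm]; rewrite /least_above; case: xgetP => [t _ //|noleast].
have [|t [[tE pt] tmin]] := @wf_least T _ (fun t => t \in E /\ (p <= t)%O) T_wf.
  by exists m.
case: (noleast t); split=> // e eE pe; rewrite leNgt; apply/negP => /tmin; exact.
Qed.

Lemma least_above_unique E p t : is_least_above E p t -> least_above E p = t.
Proof.
move=> pt; have [tE ple tmin] := pt; have [|lE pl lmin] := @least_aboveP E p.
  by exists t.
by apply/le_anti; rewrite lmin// tmin.
Qed.

Lemma least_above_id E p : p \in E -> least_above E p = p.
Proof. by move=> pE; apply: least_above_unique; split. Qed.

(** An element of [E] above [p] is also in [E'], hence above the rounding of [p] in [E']. This gives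
    the transitivity of [refines]. *)
Lemma least_above_comp E E' p : {subset E <= E'} -> (exists2 m, m \in E & (p <= m)%O) ->
  least_above E (least_above E' p) = least_above E p.
Proof.
move=> EE' pE; have [lE pl lmin] := least_aboveP pE.
apply: least_above_unique; have [|kE pk kmin] := @least_aboveP E' p.
  by have [m mE pm] := pE; exists m => //; exact: EE'.
split=> //; first by apply: kmin => //; exact: EE'.
by move=> e eE ke; apply: lmin => //; exact: le_trans ke.
Qed.

End rounding.

Section ordinal_approximation.
Context {d : Order.disp_t} {A : orderType d}.
Hypothesis A_wf : well_founded (fun a b : A => (a < b)%O).
Local Notation W := (withtop (omega_exp A)).
Local Notation L := (ordinal_space A).
Local Notation ord := (fun x : L => itv1_val x : W).
Local Notation zero := (Some omega_exp0 : W).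

Lemma ordinal_wf : well_founded (fun p q : L => (p < q)%O).
Proof.
exact: (Stdlib.Wellfounded.Inverse_Image.wf_inverse_image _ _ _ _
          (omega_exp_withtop_wf A_wf)).
Qed.

Lemma le_ordinal_max (p : L) : (p <= ordinal_max)%O.
Proof. by rewrite ord_le leNgt; case: (itv1_val p). Qed.

(** The induction of [ordinal_compact] again: on some interval [(s, q]] the function stays within
    [e / 2] of [f q], and once [q] is in [E], rounding up does not leave that interval. *)
Lemma ordinal_uniform_approx (R : realType) (f : L -> R^o) (e : R) :
  continuous f -> 0 < e ->
  exists F : seq L, forall E, {subset F <= E} -> ordinal_max \in E ->
  forall p, `|f p - f (least_above E p)| <= e.
Proof.
move=> cf e_gt0.
suff approx (t : W) : exists F : seq L, forall E, {subset F <= E} ->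
    ordinal_max \in E -> forall p : L, (ord p <= t)%O ->
    `|f p - f (least_above E p)| <= e.
  have [F FP] := approx None; exists F => E FE mE p; apply: FP => //.
  exact: (le_ordinal_max p).
elim/(well_founded_ind (omega_exp_withtop_wf A_wf)): t => t IH.
have [[q qt]|tN] := pselect (exists q : L, ord q = t); last first.
  exists [::] => E _ _ p pt; exfalso; apply: tN.
  have t0 : (zero < t)%O by apply: lt_le_trans pt; exact: itv1_gt0.
  by exists (Itv1OmegaExp t0).
have e2 : 0 < e / 2 by rewrite divr_gt0.
have /cvgrPdist_lt/(_ _ e2) := cf q.
move=> /(ordinal_nbhsP A_wf)[s [sq sU]].
rewrite qt in sq; have [F FP] := IH s sq; exists (q :: F) => E FE mE p pt.
have [sp|ps] := ltP s (ord p); last first.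
  by apply: FP => // x xF; apply: FE; rewrite inE xF orbT.
have qE : q \in E by apply: FE; rewrite mem_head.
have [|lE pl lmin] := @least_aboveP _ _ ordinal_wf E p.
  by exists ordinal_max => //; exact: le_ordinal_max.
have lq : (least_above E p <= q)%O by apply: lmin; rewrite // ord_le qt.
have fp : `|f q - f p| < e / 2 by apply: sU; rewrite /oc_itv /= sp qt.
have fl : `|f q - f (least_above E p)| < e / 2.
  by apply: sU; rewrite /oc_itv /= (lt_le_trans sp pl).
rewrite (splitr e) -(subrKA (f q)) (le_trans (ler_normD _ _))//.
by rewrite lerD// ltW// distrC.
Qed.

End ordinal_approximation.

(** * Cantor-Bendixson derivatives *)

Section cantor_bendixson_theory.
Context {d : Order.disp_t} {T : orderType d} {S : topologicalType}.
Hypothesis T_wf : well_founded (fun a b : T => (a < b)%O).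
Local Notation CB := (@cantor_bendixson d T S).

Lemma ordinal_position (a : T) : [\/ is_zero a, exists b, is_succ b a | is_limit a].
Proof.
have [[b ba]|a0] := pselect (exists b, (b < a)%O); last first.
  by constructor 1 => b ba; apply: a0; exists b.
have [[c ca]|asucc] := pselect (exists c, is_succ c a); first by constructor 2; exists c.
constructor 3; split; first by exists b.
move=> c ca; apply: contrapT => cN; apply: asucc; exists c; split=> // e ea.
by rewrite leNgt; apply/negP => ce; apply: cN; exists e.
Qed.

(** One formula for the zero, successor and limit cases, which spares later inductions the case
    split. At a successor the predecessor suffices, because its derivative already lies in all
    earlier derived sets. *)
Lemma cantor_bendixsonP a x :
  CB a x <-> forall b, (b < a)%O -> derived_set (CB b) x.
Proof.
elim/(well_founded_ind T_wf): a => a IH in x *.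
case: (ordinal_position a) => [a0|[c ac]|al].
- by rewrite cantor_bendixson0//; split=> // _ b /a0.
- have [ca cmax] := ac; rewrite (cantor_bendixsonS ac); split=> [Dx b ba|]; last by apply.
  have := cmax _ ba; rewrite le_eqVlt => /predU1P[->//|bc].
  by have [/(IH _ ca _) Dc _] := Dx; exact: Dc.
- rewrite (cantor_bendixsonL al); split=> [Dx b ba|Dx b /Dx[]//].
  have [_ /(_ b ba)[c [bc ca]]] := al.
  by have /(IH _ ca _) Dc := Dx c ca; exact: Dc.
Qed.

Lemma cantor_bendixson_derived a b : (b < a)%O -> CB a `<=` derived_set (CB b).
Proof. by move=> ba x /cantor_bendixsonP; apply. Qed.

Lemma cantor_bendixson_anti a b : (b <= a)%O -> CB a `<=` CB b.
Proof.
rewrite le_eqVlt => /predU1P[->//|ba].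
by apply: subset_trans (cantor_bendixson_derived ba) _ => x [].
Qed.

Lemma cantor_bendixson_closed a : hausdorff_space S -> closed (CB a).
Proof.
move=> /hausdorff_accessible S1; elim/(well_founded_ind T_wf): a => a IH.
rewrite (_ : CB a = \bigcap_(b in [set b | (b < a)%O]) derived_set (CB b)).
  apply: closed_bigI => b ba; apply: closedI; first exact: IH.
  exact: limit_point_closed.
by apply/seteqP; split=> x; rewrite cantor_bendixsonP.
Qed.

End cantor_bendixson_theory.

(** * Urysohn functions equal to one near a point *)

Section bump.
Context (R : realType) (K : topologicalType).
Hypothesis K_compact : compact [set: K].
Hypothesis K_hausdorff : hausdorff_space K.

Lemma bump_function (U : set K) (x : K) : open U -> U x -> exists h : K -> R^o,
  [/\ continuous h, forall y, 0 <= h y <= 1, forall y, ~ U y -> h y = 0 &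
      \forall y \near x, h y = 1].
Proof.
move=> Uo Ux.
have nK : normal_space K by exact: compact_normal.
have [|f [cf f01 fU fx]] := iffLR (uniform_separatorP (R := R) (~` U) [set x]).
  apply: (iffLR (@normal_separatorP R K) nK).
  - exact: open_closedC.
  - exact: accessible_closed_set1 (hausdorff_accessible K_hausdorff) x.
  - by apply/seteqP; split=> // y [Uy yx]; apply: Uy; rewrite yx.
(* Doubling and truncating gives the value 1 not only at [x] but wherever [f] is at least 1/2. *)
pose h y : R^o := Num.min 1 (2 * f y).
exists h; split.
- move=> y; rewrite /h; apply: (@continuous_min R K (cst 1) (fun z => 2 * f z)).
    exact: cvg_cst.
  by apply: cvgM; [exact: cvg_cst|exact: cf].
- move=> y; have /f01 : range f (f y) by exists y.
  rewrite /= in_itv /= => /andP[f0 _].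
  by rewrite ge_min lexx /= le_min ler01 mulr_ge0.
- by move=> y Uy; rewrite /h (fU (f y) (imageP _ _))//= mulr0 min_r.
- have fx1 : f x = 1 by apply: fx; exists x.
  have : \forall y \near x, 1 / 2 < f y.
    by apply: (cvgr_gt _ (cf x)); rewrite fx1 ltr_pdivrMr// mul1r ltr1n.
  by apply: filterS => y fy; rewrite /h min_l// mulrC -ler_pdivrMr// ltW.
Qed.

Lemma hausdorff_separation (x y : K) : x <> y -> exists U V : set K,
  [/\ open U, open V, U x, V y & U `&` V = set0].
Proof.
move=> /eqP xy; have := K_hausdorff; rewrite open_hausdorff => /(_ _ _ xy).
move=> [[U V] /= [xU yV] [Uo Vo UV]]; exists U, V; split=> //.
- by rewrite inE in xU.
- by rewrite inE in yV.
- exact/eqP.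
Qed.

End bump.

(** * Copies of a compact space *)

Section copies_space_structure.
Context (Gamma : choiceType) (L : topologicalType).
Hypothesis L_compact : compact [set: L].
Local Notation coprod := {_ : Gamma & L}.
Local Notation inj g p := (existT (fun=> L) g p : coprod).

Lemma existT_clopen (g : Gamma) (V : set L) : clopen V ->
  clopen ([set inj g p | p in V] : set coprod).
Proof.
move=> [Vo Vc]; split; first exact: existT_open_map.
rewrite -openC; apply/sigT_openP => g'.
have [<-|gg'] := eqVneq g g'.
  rewrite (_ : _ @^-1` _ = ~` V); first by rewrite openC.
  apply/seteqP; split=> p /=; first by move=> pV Vp; apply: pV; exists p.
  by move=> Vp [q Vq] /(congr1 (@projT2 _ (fun=> L))) /= qp; rewrite qp in Vq.
rewrite (_ : _ @^-1` _ = setT); first exact: openT.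
apply/seteqP; split=> // p _ [q _] /(congr1 (@projT1 _ _)) /= gg.
by rewrite gg eqxx in gg'.
Qed.

Lemma compact_sigT_finite (C : set coprod) : compact C ->
  finite_set [set g | exists p, C (inj g p)].
Proof.
move=> /compact_near_coveringP Ccov.
(* Along this filter a finite set of indices eventually contains any given index, and near a point
   of the sum only one index occurs. *)
pose F := filter_from [set: {fset Gamma}] (fun s => [set t : {fset Gamma} | (s `<=` t)%fset]).
have FF : Filter F.
  apply: filter_from_filter; first by exists fset0.
  move=> s t _ _; exists (s `|` t)%fset => // u /=.
  by rewrite fsubUset => /andP[].
have [|t _ tC] := Ccov _ F (fun t x => projT1 x \in t) FF.
  move=> [g p] _; exists ([set x | projT1 x = g], [set t | [fset g]%fset `<=` t]%fset).
    split=> /=; last by exists [fset g]%fset.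
    by change (nbhs p [set q | projT1 (inj g q) = g]); exact: filterE.
  by move=> [[g' p'] t] /= [-> /fsubsetP]; apply; rewrite inE.
apply: sub_finite_set (finite_fset t) => g [p Cp] /=.
exact: (tC t (fsubset_refl t) _ Cp).
Qed.

(* [pt] is the point at infinity, and any point if [Gamma] is finite: its
   neighborhoods contain all but finitely many copies in both cases. *)
Lemma copies_spaceP (g0 : Gamma) (p0 : L) :
  exists (iota : Gamma -> L -> copies_space Gamma L) (pt : copies_space Gamma L),
  [/\ compact [set: copies_space Gamma L],
      forall g, continuous (iota g),
      forall g V, clopen V -> clopen [set iota g p | p in V],
      forall g g' p p', iota g p = iota g' p' -> g = g' /\ p = p' &
      (forall (x : copies_space Gamma L) (U : set (copies_space Gamma L)),
        nbhs x U -> exists g p, U (iota g p)) /\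
      forall U, nbhs pt U -> finite_set [set g | exists p, ~ U (iota g p)]].
Proof.
have inj_inj g g' p p' : inj g p = inj g' p' -> g = g' /\ p = p'.
  move=> e; split; first exact: (congr1 (@projT1 _ _) e).
  exact: (congr1 (@projT2 _ (fun=> L)) e).
rewrite /copies_space; case: asboolP => [Ginf|/contrapT Gfin]; last first.
  exists (fun g p => inj g p), (inj g0 p0); split.
  - exact: sigT_compact.
  - by move=> g; exact: existT_continuous.
  - exact: existT_clopen.
  - exact: inj_inj.
  - split=> [[g p] U /nbhs_singleton Ux|U _]; first by exists g, p.
    exact: sub_finite_set Gfin.
exists (fun g p => Some (inj g p)), None; split.
- exact: one_point_compactification_compact.
- move=> g p; apply: continuous_comp; first exact: existT_continuous.
  exact: one_point_compactification_some_continuous.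
- move=> g V Vclopen; have [Vo Vc] := existT_clopen g Vclopen.
  have imE : [set (Some (inj g p) : one_point_compactification coprod) | p in V] =
             Some @` [set inj g p | p in V].
    by rewrite image_comp.
  rewrite imE; split; first exact: one_point_compactification_open_some.
  rewrite -openC openE => -[x|] /= xV.
    have : (~` [set inj g p | p in V]) x by move=> Vx; apply: xV; exists x.
    move=> /(conj (closed_openC Vc))/open_nbhs_nbhs.
    move=> /one_point_compactification_some_nbhs; apply: filterS.
    by move=> _ [y yV <-] [z zV [zy]]; apply: yV; rewrite -zy.
  (* The block is closed and compact, so its complement is a neighborhood of infinity. *)
  exists [set inj g p | p in V].
    split=> //; apply: continuous_compact; last first.
      by apply: (subclosed_compact _ L_compact) => //; have [] := Vclopen.
    exact/continuous_subspaceT/existT_continuous.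
  by move=> _ [[y yV <-]|->] [z zV] //= [zy]; apply: yV; rewrite -zy.
- by move=> g g' p p' /Some_inj/inj_inj.
- have bad_finite U : @nbhs _ (one_point_compactification coprod) None U ->
      finite_set [set g | exists p, ~ U (Some (inj g p))].
    move=> [C [Cc _] CU]; apply: sub_finite_set (compact_sigT_finite Cc) => g [p Up].
    by exists p; apply: contrapT => Cp; apply: Up; apply: CU; left; exists (inj g p).
  split=> // -[[g p]|] U; first by move=> /nbhs_singleton Ux; exists g, p.
  (* If [U] contained no point of a copy, all the infinitely many copies would be bad. *)
  move=> /bad_finite bad; apply: contrapT => noU; apply: Ginf.
  apply: sub_finite_set bad => g _; exists p0 => Up.
  by apply: noU; exists g, p0.
Qed.

End copies_space_structure.

(** * From an embedding to a cellular family *)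

Section supnorm_theory.
Context (R : realType) (X : topologicalType).
Implicit Types f g : Cfun R X.

Lemma Cfun_cont f : continuous (f : X -> R^o).
Proof. by case: f => f /= fc; apply/asboolP; rewrite unfold_in in fc. Qed.

Lemma continuousP_Cfun (h : X -> R^o) : continuous h -> h \in @continuous_pred R X.
Proof. by move=> hc; rewrite unfold_in; apply/asboolP. Qed.

Lemma CfunDE f g x : (f + g) x = f x + g x. Proof. by []. Qed.
Lemma CfunZE (a : R) f x : (a *: f) x = a * f x. Proof. by []. Qed.

Lemma supnorm_le f M : 0 <= M -> (forall x, `|f x| <= M) -> supnorm f <= M.
Proof.
move=> M0 fM; have [[x _]|X0] := pselect ([set: X] !=set0).
  by apply: ge_sup; [exists `|f x|, x|move=> _ [y _ <-]].
(* On the empty space the supremum is 0 by convention, whence [0 <= M]. *)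
rewrite /supnorm (_ : [set _ | _ in _] = set0) ?sup0//.
by apply/seteqP; split=> // z [y _ _]; exfalso; apply: X0; exists y.
Qed.

Lemma supnorm_ub f x : compact [set: X] -> `|f x| <= supnorm f.
Proof.
move=> Xc; apply: sup_upper_bound; last by exists x.
split; first by exists `|f x|, x.
have [|c _ fc] := @compact_EVT_max _ _ (fun y => `|f y|) _ (ex_intro _ x Logic.I) Xc.
  by apply: continuous_subspaceT => y; apply: cvg_norm; exact: Cfun_cont.
by exists `|f c| => _ [y _ <-]; apply: fc; rewrite inE.
Qed.

Lemma supnorm_attained f : compact [set: X] -> [set: X] !=set0 ->
  exists x, `|f x| = supnorm f.
Proof.
move=> Xc X0; have [|c _ fc] := @compact_EVT_max _ _ (fun y => `|f y|) _ X0 Xc.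
  by apply: continuous_subspaceT => y; apply: cvg_norm; exact: Cfun_cont.
exists c; apply/le_anti; rewrite supnorm_ub//=.
by apply: supnorm_le => // x; apply: fc; rewrite inE.
Qed.

Lemma continuous_indic (V : set X) : clopen V -> continuous (\1_V : X -> R^o).
Proof.
move=> [Vo Vc] x; have [Vx|Vx] := pselect (V x).
  rewrite /continuous_at (_ : \1_V x = 1 :> R); last by rewrite indicE mem_set.
  apply: cvg_near_cst.
  apply: filterS (open_nbhs_nbhs (conj Vo Vx)) => y Vy.
  by rewrite /indic mem_set.
rewrite /continuous_at (_ : \1_V x = 0 :> R); last by rewrite indicE memNset.
apply: cvg_near_cst.
apply: filterS (open_nbhs_nbhs (conj (closed_openC Vc) Vx)) => y Vy.
by rewrite /indic memNset.
Qed.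

(** Total in [V]: the zero function stands in when the indicator is not continuous. *)
Definition Cindic (V : set X) : Cfun R X := insubd 0 (\1_V : X -> R^o).

Lemma CindicE V x : clopen V -> Cindic V x = (x \in V)%:R.
Proof.
by move=> Vclopen; rewrite /Cindic insubdK//; exact/continuousP_Cfun/continuous_indic.
Qed.

End supnorm_theory.

Section peak_sets.
Context (R : realType) (X K : topologicalType).
Hypothesis X_compact : compact [set: X].
Hypothesis K_compact : compact [set: K].
Hypothesis K_nonempty : [set: K] !=set0.
Variable T : {linear Cfun R X -> Cfun R K}.
Hypothesis T_isometry : forall f, supnorm (T f) = supnorm f.
Local Notation ind := (@Cindic R X).

(** Both $1_V+1_W$ and $1_V-1_W$ have norm at most 1, and at [y] one of the two signs adds up the
    absolute values. *)
Lemma indic_disjoint_le (V W : set X) y : clopen V -> clopen W -> V `&` W = set0 ->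
  `|T (ind V) y| + `|T (ind W) y| <= 1.
Proof.
move=> Vc Wc VW.
have bound (a : R) : `|a| <= 1 -> `|T (ind V) y + a * T (ind W) y| <= 1.
  move=> a1; rewrite -CfunZE -CfunDE -linearZ -linearD.
  apply: le_trans (supnorm_ub _ _ K_compact) _; rewrite T_isometry.
  apply: supnorm_le => // x; rewrite CfunDE CfunZE !CindicE//.
  have [xV|xV] := boolP (x \in V).
    rewrite (_ : x \in W = false) ?mulr0 ?addr0 ?normr1//.
    apply/negP => xW; have : (V `&` W) x by split; exact: set_mem.
    by rewrite VW.
  by rewrite add0r; case: (x \in W); rewrite ?mulr1// mulr0 normr0.
have := bound 1; have := bound (-1); rewrite normrN normr1 lexx mul1r mulN1r.
move=> /(_ isT); rewrite ler_norml => /andP[l1 u1].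
move=> /(_ isT); rewrite ler_norml => /andP[l2 u2].
by case: (ger0P (T (ind V) y)); case: (ger0P (T (ind W) y)) => _ _; lra.
Qed.

Definition peak_set (V : set X) : set K := [set y | `|T (ind V) y| = 1].

Lemma peak_set_nonempty V : clopen V -> V !=set0 -> peak_set V !=set0.
Proof.
move=> Vc [x Vx]; have [y Ty] := supnorm_attained (T (ind V)) K_compact K_nonempty.
exists y; rewrite /peak_set /= Ty T_isometry; apply/le_anti/andP; split.
  apply: supnorm_le => // z; rewrite CindicE//.
  by case: (z \in V); rewrite ?normr1// normr0.
apply: le_trans (supnorm_ub (ind V) x X_compact).
by rewrite CindicE// mem_set// normr1.
Qed.

Lemma peak_set_disjoint V W y : clopen V -> clopen W -> V `&` W = set0 ->
  peak_set V y -> ~ peak_set W y.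
Proof.
move=> Vc Wc VW; rewrite /peak_set /= => Vy Wy.
by have := indic_disjoint_le y Vc Wc VW; rewrite Vy Wy; lra.
Qed.

(** Where $|T1_V|=1$, the estimate for disjoint sets forces $T1_{W\setminus V}=0$, so $T1_W=T1_V$
    there. *)
Lemma peak_setS V W : clopen V -> clopen W -> V `<=` W ->
  peak_set V `<=` peak_set W.
Proof.
move=> Vc Wc VW y; rewrite /peak_set /= => Vy.
have WVc : clopen (W `\` V).
  have [[Vo Vcl] [Wo Wcl]] := (Vc, Wc); rewrite setDE; split.
    exact: openI (closed_openC Vcl).
  exact: closedI (open_closedC Vo).
have indE : ind W = ind V + ind (W `\` V).
  apply/val_inj/funext => x; change (ind W x = ind V x + ind (W `\` V) x).
  rewrite !CindicE//; have [xV|xV] := boolP (x \in V).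
    rewrite (mem_set (VW _ (set_mem xV))) memNset ?addr0// => -[_]; apply.
    exact: set_mem.
  rewrite add0r; congr (_%:R); congr nat_of_bool; apply/idP/idP => [|xW].
    move=> xW; apply: mem_set; split; first exact: set_mem.
    by move=> Vx; rewrite mem_set in xV.
  by have [Wx _] := set_mem xW; exact: mem_set.
have := indic_disjoint_le y Vc WVc (setDIK _ _).
rewrite Vy indE linearD CfunDE -[leRHS]addr0 lerD2l normr_le0 => /eqP ->.
by rewrite addr0.
Qed.

Lemma peak_set_closed V : closed (peak_set V).
Proof.
have c : continuous (fun y => `|T (ind V) y| : R^o).
  by move=> y; apply: cvg_norm; exact: Cfun_cont.
have -> : peak_set V = (fun y => `|T (ind V) y| : R^o) @^-1` [set 1] by [].
exact: preimage_closed.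
Qed.

End peak_sets.

Lemma compact_antitone_cluster {d : Order.disp_t} (I : orderType d)
    (K : topologicalType) (D : set I) (G : I -> set K) :
  compact [set: K] -> D !=set0 -> (forall i, D i -> G i !=set0) ->
  (forall i j, D i -> D j -> (i <= j)%O -> G j `<=` G i) ->
  exists y, forall i, D i -> closure (G i) y.
Proof.
move=> Kc D0 G0 Ganti; pose F := filter_from D G.
have FF : ProperFilter F.
  apply: filter_from_proper => //; apply: filter_from_filter => // i j Di Dj.
  case: (leP i j) => ij.
    by exists j => // y Gy; split=> //; exact: (Ganti i j).
  by exists i => // y Gy; split=> //; exact: (Ganti j i Dj Di (ltW ij)).
have [y [_ yF]] := Kc F FF (@filterT _ F _).
exists y => i Di U /(yF (G i) U); apply.
by exists i.
Qed.

Section from_embedding.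
Context (R : realType) (K : topologicalType).
Hypothesis K_compact : compact [set: K].
Hypothesis K_hausdorff : hausdorff_space K.
Hypothesis K_nonempty : [set: K] !=set0.
Context (d : Order.disp_t) (alpha : orderType d).
Hypothesis alpha_wf : well_founded (fun a b : alpha => (a < b)%O).
Context (X : topologicalType).
Hypothesis X_compact : compact [set: X].
Variable T : {linear Cfun R X -> Cfun R K}.
Hypothesis T_isometry : forall f, supnorm (T f) = supnorm f.
Local Notation W := (withtop (omega_exp alpha)).
Local Notation L := (ordinal_space alpha).
Local Notation ord := (fun x : L => itv1_val x : W).
Local Notation zero := (Some omega_exp0 : W).
Local Notation CB b := (cantor_bendixson (b : withtop alpha) : set K).
Variable iota : L -> X.
Hypothesis iota_inj : injective iota.
Hypothesis iota_clopen : forall V, clopen V -> clopen [set iota p | p in V].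
Local Notation block s t := [set iota p | p in oc_itv s t].
Local Notation peak := (peak_set T).

Lemma block_clopen (s t : W) : clopen (block s t).
Proof. by apply: iota_clopen; split; [exact: oc_itv_open|exact: oc_itv_closed]. Qed.

Lemma sub_block (s s' t t' : W) : (s' <= s)%O -> (t <= t')%O ->
  block s t `<=` block s' t'.
Proof.
move=> ss tt _ [p /andP[sp pt] <-]; exists p => //.
by rewrite /oc_itv /= (le_lt_trans ss sp) (le_trans pt).
Qed.

Lemma block_disjoint (s t u : W) : block s t `&` block t u = set0.
Proof.
apply/seteqP; split=> // _ [[p /andP[_ pt] <-] [q /andP[tq _] /iota_inj qp]].
by rewrite qp in tq; move: pt; rewrite leNgt tq.
Qed.

Lemma peak_block_nonempty (s : W) (p : L) : (s < ord p)%O ->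
  peak (block s (ord p)) !=set0.
Proof.
move=> sp; apply: peak_set_nonempty => //; first exact: block_clopen.
by exists (iota p), p => //; rewrite /oc_itv /= sp lexx.
Qed.

(** Induction on [b]. For [c < b] there are points [q < p] of rank at least [c] beyond every
    [r < p], and by induction the peak sets of the intervals [(r, q]] meet $K^{(c)}$. A cluster
    point of these, as [r] grows towards [p], is an accumulation point of $K^{(c)}$ in the peak set
    of [(s, p]]. *)
Lemma peak_cantor_bendixson (b : withtop alpha) (s : W) (p : L) :
  (b <= cnf_rank (ord p))%O -> (s < ord p)%O ->
  (peak (block s (ord p)) `&` CB b) !=set0.
Proof.
elim/(well_founded_ind (withtop_wf alpha_wf)): b => b IH in s p *.
move=> bp sp.
have peakS (s1 s2 t1 t2 : W) : (s2 <= s1)%O -> (t1 <= t2)%O ->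
    peak (block s1 t1) `<=` peak (block s2 t2).
  by move=> ss tt; apply: peak_setS => //; [exact: block_clopen|exact: block_clopen|
    exact: sub_block].
have CBcl c : closed (CB c).
  exact: (cantor_bendixson_closed (withtop_wf alpha_wf)).
have derived c : (c < b)%O -> (peak (block s (ord p)) `&` derived_set (CB c)) !=set0.
  move=> cb.
  have cp : (c < cnf_rank (ord p))%O := lt_le_trans cb bp.
  pose G (r : W) := [set y : K | CB c y /\
    exists q : L, (r < ord q < ord p)%O /\ peak (block r (ord q)) y].
  pose D := [set r : W | (s <= r < ord p)%O].
  have [ | | |y yG] := @compact_antitone_cluster _ _ K D G K_compact.
  - by exists s; rewrite /D /= lexx sp.
  - move=> r /andP[sr rp]; have [q [rq qp cq]] := cnf_rank_dense alpha_wf rp cp.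
    pose q' : L := Itv1OmegaExp (le_lt_trans (omega_exp_ge0 r) rq).
    have [y [Py Cy]] := IH c cb r q' cq rq.
    by exists y; split=> //; exists q'; rewrite /= rq.
  - move=> i j _ _ ij y [Cy [q [/andP[jq qp] Py]]]; split=> //; exists q.
    by rewrite (le_lt_trans ij jq) qp; split=> //; exact: peakS Py.
  have yC : (peak (block s (ord p)) `&` CB c) y.
    have /closure_id -> : closed (peak (block s (ord p)) `&` CB c).
      by apply: closedI; [exact: peak_set_closed|exact: CBcl].
    apply: closureS (yG s _); last by rewrite /D /= lexx sp.
    move=> z [Cz [q [/andP[_ qp] Pz]]]; split=> //; apply: peakS Pz => //.
    exact: ltW.
  have [yP yCc] := yC; exists y; split=> //; split=> // U yU.
  have sD : D s by rewrite /D /= lexx sp.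
  have [z [[Cz [q [/andP[sq qp] Pz]]] Uz]] := yG s sD U yU.
  (* [z] is a peak point of [(s, q]] and [y] one of [(q, p]]; disjoint intervals have disjoint peak
     sets. *)
  exists z; split=> //; apply/eqP => zy.
  have qD : D (ord q) by rewrite /D /= (ltW sq) qp.
  have yq : peak (block (ord q) (ord p)) y.
    have /closure_id -> : closed (peak (block (ord q) (ord p))).
      exact: peak_set_closed.
    apply: closureS (yG _ qD) => x [_ [q' [/andP[_ q'p] Px]]].
    by apply: peakS Px => //; exact: ltW.
  rewrite -zy in yq.
  by apply: (peak_set_disjoint _ _ _ _ _ Pz yq) => //;
    [exact: block_clopen|exact: block_clopen|exact: block_disjoint].
have [[c cb]|b0] := pselect (exists c, (c < b)%O); last first.
  have [y Py] := peak_block_nonempty sp; exists y; split=> //.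
  apply/(cantor_bendixsonP (withtop_wf alpha_wf)) => c cb.
  by exfalso; apply: b0; exists c.
(* The point found so far depends on [c]; compactness provides one for all [c < b] at once. *)
have [ | | |y yG] := @compact_antitone_cluster _ _ K [set c | (c < b)%O]
    (fun c => peak (block s (ord p)) `&` derived_set (CB c)) K_compact.
- by exists c.
- exact: derived.
- move=> i j ib jb ij y [Py [Cy ly]]; split=> //; split.
    exact: (cantor_bendixson_anti (withtop_wf alpha_wf) ij).
  move=> U /ly[z [zy Cz Uz]]; exists z; split=> //.
  exact: (cantor_bendixson_anti (withtop_wf alpha_wf) ij).
have closedG i : closed (peak (block s (ord p)) `&` derived_set (CB i)).
  apply: closedI; first exact: peak_set_closed.
  by apply: closedI => //; apply: limit_point_closed; exact: hausdorff_accessible.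
have yD i : (i < b)%O -> (peak (block s (ord p)) `&` derived_set (CB i)) y.
  by move=> ib; have /closure_id -> := closedG i; exact: yG.
exists y; split; first by have [] := yD c cb.
by apply/(cantor_bendixsonP (withtop_wf alpha_wf)) => i /yD[].
Qed.

End from_embedding.

Lemma embedding_cellular_family (R : realType) (K : topologicalType)
    (d : Order.disp_t) (alpha : orderType d) (Gamma : choiceType) :
  compact [set: K] -> hausdorff_space K -> [set: K] !=set0 ->
  well_founded (fun a b : alpha => (a < b)%O) -> [set: Gamma] !=set0 ->
  embeds_isometrically R (copies_space Gamma (ordinal_space alpha)) K ->
  exists U : set (set K), [/\ cellular_family U,
    forall V, U V -> (cantor_bendixson (None : withtop alpha) : set K) `&` V !=set0 &
    [set: Gamma] #<= [set: set_type U]].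
Proof.
move=> Kc Kh K0 awf [g0 _] [T Tiso].
have [iota [pt [Xc iotac iotaV iota_inj _]]] :=
  copies_spaceP (ordinal_compact awf) g0 (ordinal_max : ordinal_space alpha).
pose copy g := [set iota g p | p in oc_itv (Some omega_exp0) None].
(* The bound 1/2 makes these sets disjoint, by [indic_disjoint_le], and admits the peak points,
   where the value is 1. *)
pose V g := [set y : K | 1 / 2 < `|T (Cindic R (copy g)) y|].
have copyC g : clopen (copy g).
  by apply: iotaV; split; [exact: oc_itv_open|exact: oc_itv_closed].
have Vmeet g : (cantor_bendixson (None : withtop alpha) `&` V g) !=set0.
  (* The top $\omega^\alpha$ has rank $\alpha$, and the interval ending there is the whole copy. *)
  have [ | | | |y [Py Cy]] := @peak_cantor_bendixson R K Kc Kh K0 d alpha awf _ Xc T Tiso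
    (iota g) _ _ None (Some omega_exp0) ordinal_max.
  - by move=> p q /iota_inj[].
  - exact: iotaV.
  - by [].
  - by [].
  by exists y; split=> //; rewrite /V /= Py ltr_pdivrMr// mul1r ltr1n.
have Vdisj g g' y : V g y -> V g' y -> g = g'.
  move=> Vy Vy'; apply: contrapT => gg'.
  have disj : copy g `&` copy g' = set0.
    by apply/seteqP; split=> // _ [[p _ <-] [q _ /iota_inj[/esym]]].
  have := indic_disjoint_le Kc Tiso y (copyC g) (copyC g') disj.
  by move: Vy Vy'; rewrite /V /=; lra.
exists (range V); split.
- split=> [_ [g _ <-]|].
    split; last by have [y [_ Vy]] := Vmeet g; exists y.
    have c : continuous (fun y => `|T (Cindic R (copy g)) y| : R^o).
      by move=> y; apply: cvg_norm; exact: Cfun_cont.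
    rewrite (_ : V g = (fun y => `|T (Cindic R (copy g)) y| : R^o) @^-1` [set x | 1 / 2 < x])//.
    by move/continuousP: c; apply; exact: open_gt.
  by move=> _ _ [g _ <-] [g' _ <-] [y [Vy Vy']]; rewrite (Vdisj _ _ _ Vy Vy').
- by move=> _ [g _ <-].
- apply/card_leTP; exists (fun g => SigSub (mem_set (imageP V (I : [set: Gamma] g)))).
  move=> g g' /(congr1 val) /= VV; have [y [_ Vy]] := Vmeet g.
  by apply: (Vdisj _ _ y) => //; rewrite -VV.
Qed.

(** * From a cellular family to an embedding *)

Section weights.
Context (R : realType) (K : topologicalType).
Hypothesis K_compact : compact [set: K].
Hypothesis K_hausdorff : hausdorff_space K.
Context (d : Order.disp_t) (alpha : orderType d).
Hypothesis alpha_wf : well_founded (fun a b : alpha => (a < b)%O).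
Local Notation W := (withtop (omega_exp alpha)).
Local Notation L := (ordinal_space alpha).
Local Notation ord := (fun x : L => itv1_val x : W).
Local Notation zero := (Some omega_exp0 : W).
Local Notation CB b := (cantor_bendixson (b : withtop alpha) : set K).
Local Notation rank p := (cnf_rank (ord p)).

Definition weighted_sum (E : seq L) (w : L -> K -> R) (f : L -> R) (y : K) : R :=
  \sum_(q <- E) f q * w q y.

(* [weights_rank] makes [q] the only point of maximal rank among those that round
   up to [q] in [E], so one point of [K^(rank q)] with weight [1] is enough to
   accommodate all later refinements. *)
Record weights (U : set K) (E : seq L) (w : L -> K -> R) : Prop := Weights {
  weights_uniq : uniq E;
  weights_max : ordinal_max \in E;
  weights_cont : forall q, continuous (w q : K -> R^o);
  weights_ge0 : forall q y, 0 <= w q y;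
  weights_le1 : forall y, weighted_sum E w (cst 1) y <= 1;
  weights_out : forall q y, q \in E -> ~ U y -> w q y = 0;
  weights_peak : forall q, q \in E ->
    exists x, CB (rank q) x /\ \forall y \near x, w q y = 1;
  weights_rank : forall r t, is_least_above E r t -> (r < t)%O ->
    (rank r < rank t)%O }.

(** The finer operator, applied to [f] rounded up to [E], returns the coarser one. For constant [f]
    this fixes the total weight; in general it turns the difference of two stages into a rounding
    error. *)
Definition refines (E : seq L) (w : L -> K -> R) (E' : seq L) (w' : L -> K -> R) :=
  {subset E <= E'} /\
  forall f y, weighted_sum E w f y = weighted_sum E' w' (f \o least_above E) y.

Lemma least_aboveL (E : seq L) p : ordinal_max \in E ->
  is_least_above E p (least_above E p).
Proof.
by move=> mE; apply: (least_aboveP (ordinal_wf alpha_wf)); exists ordinal_max;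
  rewrite ?le_ordinal_max.
Qed.

Lemma least_aboveL_id (E : seq L) p : p \in E -> least_above E p = p.
Proof. exact: (least_above_id (ordinal_wf alpha_wf)). Qed.

Lemma refines_trans E w E' w' E'' w'' : ordinal_max \in E ->
  refines E w E' w' -> refines E' w' E'' w'' -> refines E w E'' w''.
Proof.
move=> mE [EE' ww'] [EE'' ww'']; split=> [q /EE'/EE''//|f y].
rewrite ww' ww''; apply: eq_bigr => q _ /=.
rewrite (least_above_comp (ordinal_wf alpha_wf) EE')//.
by exists ordinal_max => //; exact: le_ordinal_max.
Qed.

Lemma refines_refl E w : refines E w E w.
Proof.
split=> // f y; apply: eq_big_seq => q qE /=.
by rewrite least_aboveL_id.
Qed.

Lemma weights_start (U : set K) x : open U -> U x -> CB None x ->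
  exists E w, weights U E w.
Proof.
move=> Uo Ux Cx; have [h [hc h01 hU hx]] := bump_function R K_compact K_hausdorff Uo Ux.
exists [:: ordinal_max], (fun=> h); split.
- by [].
- by rewrite inE.
- by [].
- by move=> _ y; have /andP[] := h01 y.
- by move=> y; rewrite /weighted_sum big_seq1 mul1r; have /andP[] := h01 y.
- by move=> q y _ /hU.
- by move=> q; rewrite inE => /eqP ->; exists x.
- move=> r t [+ _ _]; rewrite inE => /eqP -> rmax.
  rewrite ord_lt in rmax; have := itv1_gt0 r.
  case: (itv1_val r) rmax => [g _ /omega_exp_gt0|//].
  by move=> /(cnf_rankP alpha_wf)[m [-> _ _]].
Qed.

(** The successor [t] of [p] in [E] has larger rank, so its peak point [x] is a limit of points of
    $K^{(\beta)}$, where $\beta$ is the rank of [p]. One of them, [x'], differs from [x] and lies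
    where [w t] is 1. A bump [h] around [x'], zero near [x], becomes the weight of [p] and is
    subtracted from that of [t]. *)
Lemma weights_step (U : set K) E w (p : L) (s : W) :
  weights U E w -> p \notin E ->
  (s < ord p)%O -> (forall q, ord q = s -> q \in E) ->
  (forall r, (s < r)%O -> (r < ord p)%O -> (cnf_rank r < rank p)%O) ->
  exists E' w', [/\ weights U E' w', refines E w E' w' & p \in E'].
Proof.
move=> [Euniq mE wc w0 w1 wU wpeak wrank] pE sp sE gap.
set t := least_above E p.
have [tE pt tmin] := least_aboveL p mE.
rewrite -/t in tE pt tmin.
have tp : (t == p) = false by apply/eqP => tp; rewrite -tp tE in pE.
have {}pt : (p < t)%O by rewrite lt_neqAle pt eq_sym tp.
have pt_rank : (rank p < rank t)%O by apply: wrank => //; exact: least_aboveL.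
have [x [Ct xt]] := wpeak t tE.
have [Cx Lx] := cantor_bendixson_derived (withtop_wf alpha_wf) pt_rank Ct.
have {xt} : nbhs x [set y | w t y = 1] := xt; rewrite nbhsE => -[N [No Nx] Nt].
have [x' [x'x Cx' Nx']] := Lx N (open_nbhs_nbhs (conj No Nx)).
have [V [V' [Vo V'o Vx V'x' VV']]] := hausdorff_separation K_hausdorff (elimN eqP x'x).
have [h [hc h01 hN hx']] := bump_function R K_compact K_hausdorff
  (openI No Vo) (conj Nx' Vx).
(* The bump lives where [w t] is 1, so the remaining weight of [t] is nonnegative. *)
have ht y : h y <= w t y.
  have [[Ny _]|Ny] := pselect ((N `&` V) y); last by rewrite hN.
  by rewrite (Nt y Ny : w t y = 1); have /andP[] := h01 y.
pose w' (q : L) (y : K) := if q == p then h y else if q == t then w t y - h y else w q y.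
(* The correction vanishes when [f p = f t], as for constants and for functions rounded up to
   [E]. *)
have sumE f y : weighted_sum (p :: E) w' f y = weighted_sum E w f y + (f p - f t) * h y.
  rewrite /weighted_sum big_cons {1}/w' eqxx.
  rewrite [X in _ + X = _](bigD1_seq t)//= {1}/w' tp eqxx.
  rewrite [X in _ = X + _](bigD1_seq t)//=.
  rewrite [X in _ + (_ + X) = _]big_seq_cond [X in _ = _ + X + _]big_seq_cond.
  rewrite (eq_bigr (fun q => f q * w q y)); first by ring.
  move=> q /andP[qE qt]; rewrite /w' (negPf qt); case: eqP => // qp.
  by rewrite -qp qE in pE.
exists (p :: E), w'; split.
- split.
  + by rewrite /= pE.
  + by rewrite inE mE orbT.
  + move=> q; rewrite /w'; case: (q == p); first exact: hc.
    case: (q == t); last exact: wc.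
    by move=> y; apply: cvgB; [exact: wc|exact: hc].
  + move=> q y; rewrite /w'; case: ifP => _; first by have /andP[] := h01 y.
    by case: ifP => _; rewrite ?subr_ge0.
  + by move=> y; rewrite sumE subrr mul0r addr0.
  + move=> q y qE Uy; have ht0 : h y = 0.
      apply/le_anti; rewrite -{1}(wU t y tE Uy) ht.
      by have /andP[] := h01 y.
    rewrite /w'; case: eqP => [//|qp]; case: eqP => [_|_]; first by rewrite ht0 subr0 wU.
    by apply: wU => //; move: qE; rewrite inE => /predU1P[].
  + move=> q; rewrite inE /w'; have [-> _|qp /= qE] := eqVneq q p.
      by exists x'.
    have [qt|qt] := eqVneq q t; last exact: wpeak.
    exists x; rewrite qt; split=> //.
    have : \forall y \near x, N y /\ V' y.
      apply: filterI; apply: open_nbhs_nbhs; by split.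
    apply: filterS => y [Ny V'y]; rewrite (Nt y Ny : w t y = 1) hN ?subr0// => -[_ Vy].
    by have : (V `&` V') y by []; rewrite VV'.
  + move=> r u [uE ru umin] r_lt_u; move: uE; rewrite inE => /predU1P[up|uE].
      (* A point that rounds up to [p] lies above [s]: otherwise [s] would be a point of [E], met
         before [p]. *)
      rewrite up; apply: gap; last by rewrite -ord_lt -up.
      rewrite ltNge; apply/negP => rs.
      have s0 : (zero < s)%O by apply: lt_le_trans rs; exact: itv1_gt0.
      have := umin (Itv1OmegaExp s0); rewrite inE sE// orbT => /(_ isT rs).
      by rewrite ord_le up leNgt sp.
    apply: wrank => //; split=> // e eE; apply: umin.
    by rewrite inE eE orbT.
- split=> [q qE|f y]; first by rewrite inE qE orbT.
  rewrite sumE /= (least_aboveL_id tE) subrr mul0r addr0.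
  by have [_ ->] := refines_refl E w.
- by rewrite mem_head.
Qed.

End weights.

Lemma continuous_uniform_approx (R : realType) (K : topologicalType) (F : K -> R^o) :
  (forall e : R, 0 < e -> exists2 h : K -> R^o, continuous h & forall y, `|F y - h y| <= e) ->
  continuous F.
Proof.
move=> Fh y; apply/cvgrPdist_le => e e0.
have e3 : 0 < e / 3 by rewrite divr_gt0.
have [h hc Fhe] := Fh _ e3.
have /cvgrPdist_le/(_ _ e3) := hc y; apply: filterS => z hz.
have := Fhe y; have := Fhe z.
move: hz; rewrite !ler_norml => /andP[a1 a2] /andP[b1 b2] /andP[d1 d2].
by apply/andP; split; lra.
Qed.

Section block_operator.
Context (R : realType) (K : topologicalType).
Hypothesis K_compact : compact [set: K].
Hypothesis K_hausdorff : hausdorff_space K.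
Context (d : Order.disp_t) (alpha : orderType d).
Hypothesis alpha_wf : well_founded (fun a b : alpha => (a < b)%O).
Hypothesis alpha_countable : countable [set: alpha].
Local Notation W := (withtop (omega_exp alpha)).
Local Notation L := (ordinal_space alpha).
Local Notation ord := (fun x : L => itv1_val x : W).
Local Notation CB b := (cantor_bendixson (b : withtop alpha) : set K).
Implicit Types (E : seq L) (w : L -> K -> R) (f g : L -> R).

(** Well-founded recursion on [p]: the lower end [s] of the gap below [p] is inserted first, unless
    it is zero, which is not a point of [L]. *)
Lemma weights_extend (U : set K) E w p : weights U E w ->
  exists E' w', [/\ weights U E' w', refines E w E' w' & p \in E'].
Proof.
elim/(well_founded_ind (ordinal_wf alpha_wf)): p => p IH in E w *.
move=> Ew; have [pE|pE] := boolP (p \in E).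
  by exists E, w; split=> //; exact: (refines_refl alpha_wf).
have [s [sp gap]] := cnf_rank_gap alpha_wf (itv1_gt0 p).
have [[q qs]|sN] := pselect (exists q : L, ord q = s); last first.
  apply: (weights_step K_compact K_hausdorff alpha_wf Ew pE sp) => // q qs.
  by exfalso; apply: sN; exists q.
have [|E1 [w1 [Ew1 r1 qE1]]] := IH q _ E w Ew; first by rewrite ord_lt qs.
have [pE1|pE1] := boolP (p \in E1); first by exists E1, w1.
have [|E2 [w2 [Ew2 r2 pE2]]] :=
    weights_step K_compact K_hausdorff alpha_wf Ew1 pE1 sp _ gap.
  move=> q' q's; have -> : q' = q by apply: val_inj; rewrite /= q's.
  by [].
exists E2, w2; split=> //.
exact: (refines_trans alpha_wf (weights_max Ew) r1 r2).
Qed.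

Lemma ordinal_enum : exists e : nat -> L, forall q, exists n, e n = q.
Proof.
have /countable_injP[c cinj] := omega_exp_countable alpha_countable.
pose code (q : L) := if itv1_val q is Some f then (c f).+1 else 0%N.
have code_inj : injective code.
  move=> p q pq; apply: val_inj => /=; move: pq; rewrite /code.
  case: (itv1_val p) (itv1_val q) => [f|] [g|] //= [] fg.
  by congr Some; apply: cinj; rewrite ?inE.
exists (fun n => xget ordinal_max [set q | code q = n]) => q; exists (code q).
case: xgetP => [x _ /code_inj//|/(_ q) qN]; by exfalso; exact: qN.
Qed.

Lemma weights_sequence (U : set K) x : open U -> U x -> CB None x ->
  exists (E : nat -> seq L) (w : nat -> L -> K -> R),
  [/\ forall n, weights U (E n) (w n),
      forall n m, (n <= m)%N -> refines (E n) (w n) (E m) (w m) &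
      forall q, exists n, q \in E n].
Proof.
move=> Uo Ux Cx; have [e esurj] := ordinal_enum.
have [E0 [w0 Ew0]] := weights_start R K_compact K_hausdorff alpha_wf Uo Ux Cx.
pose state := {s : seq L * (L -> K -> R) | weights U s.1 s.2}.
have /choice[next nextP] (ns : nat * state) : exists s' : state,
    refines (sval ns.2).1 (sval ns.2).2 (sval s').1 (sval s').2 /\
    e ns.1 \in (sval s').1.
  have [E' [w' [Ew' r' e']]] := weights_extend (e ns.1) (proj2_sig ns.2).
  by exists (exist _ (E', w') Ew').
(* Stage [m.+1] adjoins the point [e m]. *)
pose s := fix s n : state := if n is m.+1 then next (m, s m) else exist _ (E0, w0) Ew0.
exists (fun n => (sval (s n)).1), (fun n => (sval (s n)).2); split.
- by move=> n; exact: proj2_sig (s n).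
- move=> n m /subnK <-; elim: (m - n)%N => [|k IH].
    exact: (refines_refl alpha_wf).
  apply: (refines_trans alpha_wf (weights_max (proj2_sig (s n))) IH).
  by have [] := nextP (k + n, s (k + n))%N.
- by move=> q; have [n <-] := esurj q; exists n.+1; have [] := nextP (n, s n).
Qed.

Lemma weighted_sum_linear E w (a : R) f g y :
  weighted_sum E w (fun q => a * f q + g q) y =
  a * weighted_sum E w f y + weighted_sum E w g y.
Proof.
rewrite /weighted_sum mulr_sumr -big_split /=.
by apply: eq_bigr => q _; rewrite mulrDl mulrA.
Qed.

Lemma weighted_sum_bound U E w f (M : R) y : weights U E w ->
  (forall q, `|f q| <= M) ->
  `|weighted_sum E w f y| <= M * weighted_sum E w (cst 1) y.
Proof.
move=> Ew fM; rewrite /weighted_sum (le_trans (ler_norm_sum _ _ _))//.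
rewrite mulr_sumr ler_sum// => q _; rewrite normrM mul1r.
by rewrite (ger0_norm (weights_ge0 Ew _ _)) ler_wpM2r// (weights_ge0 Ew).
Qed.

(** The total weight is at most 1, so the other weights vanish where [w q] is 1. *)
Lemma weighted_sum_peak U E w f q y : weights U E w -> q \in E -> w q y = 1 ->
  weighted_sum E w f y = f q.
Proof.
move=> Ew qE wq; have w0 r : r \in E -> r != q -> w r y = 0.
  move=> rE rq; apply/le_anti; rewrite (weights_ge0 Ew) andbT.
  have := weights_le1 Ew y; rewrite /weighted_sum (bigD1_seq q)//=; last exact: weights_uniq Ew.
  rewrite wq mul1r -[leRHS]addr0 lerD2l; apply: le_trans.
  rewrite (big_rem r)//= rq mul1r lerDl; apply: sumr_ge0 => i _.
  by rewrite mul1r (weights_ge0 Ew).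
rewrite /weighted_sum (bigD1_seq q)//=; last exact: weights_uniq Ew.
rewrite wq mulr1 big_seq_cond big1 ?addr0// => r /andP[rE rq].
by rewrite w0// mulr0.
Qed.

Lemma weighted_sum_continuous U E w f : weights U E w ->
  continuous (weighted_sum E w f : K -> R^o).
Proof.
move=> Ew; apply: continuous_big => [|q _ y]; first exact: add_continuous.
by apply: cvgM; [exact: cvg_cst|exact: (weights_cont Ew)].
Qed.

(** [S f] is the limit of the weighted sums of [f], shown to exist for continuous [f]. The last
    clause is isometry in a form suited to gluing: [f q] is nearly attained at a point where the
    image of the constant 1 is 1. *)
Lemma block_operator (U : set K) x : open U -> U x -> CB None x ->
  exists S : (L -> R) -> K -> R,
  [/\ forall a f g y, continuous (f : L -> R^o) -> continuous (g : L -> R^o) ->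
        S (fun q => a * f q + g q) y = a * S f y + S g y,
      forall f, continuous (f : L -> R^o) -> continuous (S f : K -> R^o),
      forall f y, ~ U y -> S f y = 0,
      (forall y, 0 <= S (cst 1) y <= 1) /\
      forall f M y, continuous (f : L -> R^o) -> (forall q, `|f q| <= M) ->
        `|S f y| <= M * S (cst 1) y &
      forall f q e, continuous (f : L -> R^o) -> 0 < e ->
        exists y, S (cst 1) y = 1 /\ `|S f y - f q| <= e].
Proof.
move=> Uo Ux Cx; have [E [w [Ew Er Ecover]]] := weights_sequence Uo Ux Cx.
pose t n f y := weighted_sum (E n) (w n) f y.
have t_uniform f e : continuous (f : L -> R^o) -> 0 < e ->
    exists N, forall n m y, (N <= n)%N -> (n <= m)%N -> `|t m f y - t n f y| <= e.
  move=> fc e0; have [F FP] := ordinal_uniform_approx alpha_wf fc e0.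
  have [N FN] : exists N, {subset F <= E N}.
    elim: F {FP} => [|q F [N FN]]; first by exists 0%N.
    have [n qn] := Ecover q; exists (maxn n N) => r; rewrite inE => /predU1P[->|/FN rN].
      by have [sub _] := Er n (maxn n N) (leq_maxl _ _); exact: sub.
    by have [sub _] := Er N (maxn n N) (leq_maxr _ _); exact: sub.
  exists N => n m y Nn nm; have [_ tr] := Er n m nm.
  (* The difference is the later weighted sum of the rounding error of [f], which is at most [e],
     with total weight at most 1. *)
  rewrite /t tr -[X in _ - X]mul1r -mulN1r mulrA mulr1 addrC -weighted_sum_linear.
  apply: (le_trans (weighted_sum_bound (M := e) _ (Ew m) _)).
    move=> q; rewrite mulN1r addrC; apply: FP; last exact: weights_max (Ew n).
    by have [sub _] := Er N n Nn => r /FN/sub.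
  by rewrite -[leRHS]mulr1 ler_wpM2l ?(ltW e0)// (weights_le1 (Ew m)).
pose S f y := lim (t n f y @[n --> \oo]) : R^o.
have t_cvg f y : continuous (f : L -> R^o) -> t n f y @[n --> \oo] --> (S f y : R^o).
  move=> fc; apply/cauchy_cvgP; apply/cauchy_exP => e e0.
  have e2 : 0 < e / 2 by rewrite divr_gt0.
  have [N NP] := t_uniform f _ fc e2.
  exists (t N f y).
  suff : \forall n \near \oo, ball (t N f y) e (t n f y) by [].
  near=> n; rewrite /ball /= distrC.
  apply: (@le_lt_trans _ _ (e / 2)); last by rewrite ltr_pdivrMr// ltr_pMr// ltr1n.
  apply: (NP N n y (leqnn N)).
  by near: n; exact: nbhs_infty_ge.
have S_approx f e : continuous (f : L -> R^o) -> 0 < e ->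
    exists N, forall n y, (N <= n)%N -> `|S f y - t n f y| <= e.
  move=> fc e0; have [N NP] := t_uniform f e fc e0; exists N => n y Nn.
  apply/ler_addgt0Pr => c c0.
  have /cvgrPdist_lt/(_ c c0) := t_cvg f y fc.
  move=> [M _ MP]; have /= := MP (maxn n M) (leq_maxr _ _).
  have := NP n (maxn n M) y Nn (leq_maxl _ _) => tt St.
  rewrite -(subrKA (t (maxn n M) f y)) (le_trans (ler_normD _ _))//.
  by rewrite addrC lerD// ltW.
have c1 : continuous (cst 1 : L -> R^o) by exact: cst_continuous.
have S1 n y : S (cst 1) y = t n (cst 1) y.
  apply: cvg_lim => //; apply: cvg_near_cst; near=> m.
  have nm : (n <= m)%N by near: m; exact: nbhs_infty_ge.
  by have [_ tr] := Er n m nm; rewrite /t tr.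
exists S; split.
- move=> a f g y fc gc; apply: cvg_lim => //.
  rewrite (_ : (fun _ => _) = fun n => a * t n f y + t n g y); last first.
    by apply/funext => n; rewrite /t weighted_sum_linear.
  by apply: cvgD; [apply: cvgM; [exact: cvg_cst|exact: t_cvg]|exact: t_cvg].
- move=> f fc; apply: continuous_uniform_approx => e e0.
  have [N NP] := S_approx f e fc e0.
  exists (t N f); first exact: weighted_sum_continuous (Ew N).
  by move=> y; exact: NP.
- move=> f y Uy; apply: cvg_lim => //; apply: cvg_near_cst; apply: nearW => n.
  rewrite /t /weighted_sum big_seq big1// => q qE.
  by rewrite (weights_out (Ew n) qE Uy) mulr0.
- split=> [y|f M y fc fM].
    rewrite (S1 0%N) (weights_le1 (Ew 0%N)) andbT.
    by apply: sumr_ge0 => q _; rewrite mul1r (weights_ge0 (Ew 0%N)).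
  apply/ler_addgt0Pr => c c0; have [N NP] := S_approx f c fc c0.
  have := weighted_sum_bound y (Ew N) fM; rewrite (S1 N) -/(t N f y) -/(t N _ y).
  have := NP N y (leqnn N) => St tM.
  by rewrite -[S f y](subrK (t N f y)) (le_trans (ler_normD _ _))// addrC lerD.
- move=> f q e fc e0; have [N NP] := S_approx f e fc e0.
  (* Stage [m] contains [q] and is within [e] of the limit; at a peak point of [q] it returns [f q]
     exactly. *)
  have [n qn] := Ecover q; pose m := maxn n N.
  have qm : q \in E m by have [sub _] := Er n m (leq_maxl _ _); exact: sub.
  have [y [_ /nbhs_singleton wq]] := weights_peak (Ew m) qm.
  exists y; rewrite (S1 m) /t (weighted_sum_peak _ (Ew m) qm wq).
  have := NP m y (leq_maxr _ _).
  by rewrite /t (weighted_sum_peak _ (Ew m) qm wq).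
Unshelve. all: by end_near.
Qed.

End block_operator.

Lemma embeds_copies_space (R : realType) (K : topologicalType)
    (d : Order.disp_t) (alpha : orderType d) (Gamma : choiceType) (V : Gamma -> set K) :
  compact [set: K] -> hausdorff_space K ->
  well_founded (fun a b : alpha => (a < b)%O) -> countable [set: alpha] ->
  [set: Gamma] !=set0 -> (forall g, open (V g)) ->
  (forall g g' y, V g y -> V g' y -> g = g') ->
  (forall g, (cantor_bendixson (None : withtop alpha) `&` V g) !=set0) ->
  embeds_isometrically R (copies_space Gamma (ordinal_space alpha)) K.
Proof.
move=> Kc Kh awf actb [g0 _] Vo Vdisj Vmeet.
pose L := ordinal_space alpha.
have [iota [pt [Xc iotac _ _ [dense bad]]]] :=
  copies_spaceP (ordinal_compact awf) g0 (ordinal_max : ordinal_space alpha).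
have /choice[S SP] g : exists S : (L -> R) -> K -> R, _ :=
  let: ex_intro x (conj Cx Vx) := Vmeet g in
  block_operator R Kc Kh awf actb (Vo g) Vx Cx.
have /choice[idx idxP] (y : K) : exists o : option Gamma,
    if o is Some g then V g y else forall g, ~ V g y.
  have [[g Vy]|Vy] := pselect (exists g, V g y); first by exists (Some g).
  by exists None => g Vgy; apply: Vy; exists g.
have idx_some g y : V g y -> idx y = Some g.
  move=> Vy; have := idxP y; case: (idx y) => [g' /Vdisj/(_ Vy) -> //|/(_ g)].
  by [].
set X := copies_space Gamma (ordinal_space alpha) in iota pt Xc iotac dense bad *.
pose local (f : Cfun R X) g : L -> R := fun q => f (iota g q) - f pt.
pose pull (f : Cfun R X) g : L -> R := fun q => f (iota g q).
have pullc f g : continuous (pull f g : L -> R^o).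
  by move=> q; apply: continuous_comp; [exact: iotac|exact: Cfun_cont].
have localc f g : continuous (local f g : L -> R^o).
  move=> q; apply: (@cvgB R R^o L (nbhs q) _ (pull f g) (cst (f pt)) (pull f g q) (f pt)).
    exact: pullc.
  exact: cvg_cst.
(* This is [f pt] plus the sum of [S g (local f g)] over all [g]: at [y] only the summand of the set
   [V g] containing [y] can be nonzero. *)
pose T0 (f : Cfun R X) (y : K) : R^o :=
  f pt + (if idx y is Some g then S g (local f g) y else 0).
have T0c f : continuous (T0 f).
  apply: continuous_uniform_approx => e e0.
  have : nbhs pt [set x | `|f pt - f x| <= e].
    by have /cvgrPdist_le/(_ e e0) := @Cfun_cont R X f pt.
  (* For [g] outside the finite set [B], [local f g] is bounded by [e], so the finite sum over [B]
     approximates [T0 f] within [e]. *)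
  move=> /bad Bfin; pose B := fset_set [set g | exists p, ~ `|f pt - f (iota g p)| <= e].
  exists (fun y => f pt + \sum_(g <- B) S g (local f g) y).
    move=> y; apply: cvgD; first exact: cvg_cst.
    apply: continuous_big => [|g _]; first exact: add_continuous.
    have [_ Sc _ _ _] := SP g.
    exact: Sc.
  move=> y; rewrite /T0 opprD addrACA subrr add0r.
  have S0 h : ~ V h y -> S h (local f h) y = 0.
    by move=> Vh; have [_ _ Sout _ _] := SP h; exact: Sout.
  have := idxP y; case: (idx y) => [g Vg|noV]; last first.
    by rewrite big1 ?subr0 ?normr0 ?ltW// => h _; exact: S0.
  have S0g h : h != g -> S h (local f h) y = 0.
    by move=> hg; apply: S0 => Vh; rewrite (Vdisj _ _ _ Vh Vg) eqxx in hg.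
  have [gB|gB] := boolP (g \in B).
    by rewrite (bigD1_seq g)//= big1 ?addr0 ?subrr ?normr0 ?ltW// => h /S0g.
  rewrite big_seq big1 => [|h hB]; last first.
    by apply: S0g; apply: contraNneq gB => <-.
  rewrite subr0; have [_ _ _ [S01 Sbound] _] := SP g.
  have /andP[_ S1] := S01 y.
  apply: le_trans (Sbound _ e _ (localc f g) _) _.
    move=> q; rewrite distrC; apply: contrapT => fq; move/negP: gB; apply.
    by rewrite in_fset_set// inE; exists q.
  by rewrite -[leRHS]mulr1 ler_wpM2l// ltW.
pose T1 f : Cfun R K := CFun (continuousP_Cfun (T0c f)).
have T1lin : linear T1.
  move=> a f g; apply/val_inj/funext => y; change (T0 (a *: f + g) y = a * T0 f y + T0 g y).
  rewrite /T0; case: (idx y) => [h|]; last by rewrite !addr0.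
  have [Slin _ _ _ _] := SP h.
  have -> : local (a *: f + g) h = (fun q => a * local f h q + local g h q).
    apply/funext => q; rewrite /local !CfunDE !CfunZE; ring.
  rewrite Slin// CfunDE CfunZE; ring.
pose T : {linear Cfun R X -> Cfun R K} := HB.pack T1 (GRing.isLinear.Build _ _ _ _ T1 T1lin).
exists T => f.
(* The upper bound comes from this form: [f pt] has coefficient [1 - S g (cst 1) y], and the other
   term is at most [S g (cst 1) y] times the norm of [f]. *)
have T_some g y : V g y -> T f y = f pt * (1 - S g (cst 1) y) + S g (pull f g) y.
  move=> /idx_some idxy; change (T0 f y = f pt * (1 - S g (cst 1) y) + S g (pull f g) y).
  rewrite /T0 idxy; have [Slin _ _ _ _] := SP g.
  have -> : local f g = (fun q => (- f pt) * cst 1 q + pull f g q).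
    by apply/funext => q; rewrite /local /pull /cst mulr1 addrC.
  by rewrite Slin//; [ring|exact: cst_continuous].
have T_none y : (forall g, ~ V g y) -> T f y = f pt.
  move=> Vy; change (T0 f y = f pt); rewrite /T0.
  by have := idxP y; case: (idx y) => [g /Vy//|_]; rewrite addr0.
apply/le_anti/andP; split.
  apply: supnorm_le => [|y].
    by apply: le_trans (supnorm_ub f pt Xc); rewrite normr_ge0.
  have [[g Vy]|Vy] := pselect (exists g, V g y); last first.
    rewrite T_none ?supnorm_ub// => g Vgy.
    by apply: Vy; exists g.
  rewrite (T_some g)//; have [_ _ _ [S01 Sbound] _] := SP g.
  have /andP[S0 S1] := S01 y.
  apply: le_trans (ler_normD _ _) _.
  have := Sbound (pull f g) (supnorm f) y (pullc f g) (fun q => supnorm_ub f _ Xc).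
  have : `|f pt * (1 - S g (cst 1) y)| <= supnorm f * (1 - S g (cst 1) y).
    rewrite normrM (@ger0_norm _ (1 - _)) ?subr_ge0// ler_wpM2r ?subr_ge0//.
    exact: supnorm_ub.
  lra.
have TK y : `|T f y| <= supnorm (T f) by exact: supnorm_ub.
apply: supnorm_le => [|x].
  have [y _] := Vmeet g0.
  by apply: le_trans (TK y); rewrite normr_ge0.
(* Any value of [f] is nearly a value on some copy, and this is nearly attained at a point where
   [S g (cst 1)] is 1 and the term in [f pt] drops out. *)
apply/ler_addgt0Pr => e e0; have e2 : 0 < e / 2 by rewrite divr_gt0.
have /cvgrPdist_le/(_ _ e2)/dense[g [q fx]] := @Cfun_cont R X f x.
have [_ _ Sout _ Speak] := SP g.
have [y [Sy1 Sy]] := Speak (pull f g) q _ (pullc f g) e2.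
have Vy : V g y.
  by apply: contrapT => /(Sout (cst 1)) Sy0; move: Sy1; rewrite Sy0 => /esym/eqP; rewrite oner_eq0.
have := TK y; rewrite (T_some g y Vy) Sy1 subrr mulr0 add0r => Sle.
have -> : f x = (f x - f (iota g q)) + (f (iota g q) - S g (pull f g) y) + S g (pull f g) y.
  by ring.
apply: le_trans (ler_normD _ _) _; rewrite addrC lerD//.
apply: le_trans (ler_normD _ _) _; rewrite [leRHS]splitr lerD// distrC.
exact: Sy.
Qed.

Theorem theorem1p3 (R : realType)
    (K : topologicalType) (K_compact : compact [set: K])
    (K_hausdorff : hausdorff_space K) (K_infinite : infinite_set [set: K])
    (d : Order.disp_t) (alpha : orderType d)
    (alpha_wf : well_founded (fun a b : alpha => (a < b)%O))
    (alpha_countable : countable [set: alpha]) :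
  exists kappa : Type,
    is_relative_cellularity
      (cantor_bendixson (None : withtop alpha) : set K) kappa /\
    is_card_sup
      (fun Gamma : choiceType =>
         [set: Gamma] !=set0 /\
         embeds_isometrically R (copies_space Gamma (ordinal_space alpha)) K)
      (fun Gamma : choiceType => Gamma : Type) kappa.
Proof.
have K0 : [set: K] !=set0 by exact: infinite_setN0.
set A : set K := cantor_bendixson (None : withtop alpha).
(* Cellular families are sets of subsets of [K], so [set K] bounds their cardinals. *)
have [kappa kappaP] := @card_sup_exists (set (set K))
  (fun U => cellular_family U /\ forall V, U V -> A `&` V !=set0)
  (fun U => set_type U) (set K)
  (fun U _ => iffRL (card_leTP _ _) (ex_intro _ set_val val_inj)).
exists (set_type kappa); split=> //.
have [kappa_ub kappa_min] := kappaP.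
split=> [Gamma [G0 Gemb]|lambda lambda_ub].
  have [U [Ucell UA GU]] :=
    embedding_cellular_family K_compact K_hausdorff K0 alpha_wf G0 Gemb.
  by apply: card_le_trans GU _; exact: kappa_ub.
apply: kappa_min => U [[Uopen Utriv] UA].
(* A nonempty family is its own index set [Gamma]. The empty family gives no admissible [Gamma], but
   it injects into any [lambda]. *)
have [[V UV]|U0] := pselect (exists V, U V); last first.
  apply/card_leTP; exists (fun V => False_rect _ (U0 (ex_intro _ (val V) (set_valP V)))).
  by move=> V; exfalso; apply: U0; exists (val V); exact: set_valP.
apply: (lambda_ub (set_type U : choiceType)); split; first by exists (SigSub (mem_set UV)).
apply: (@embeds_copies_space R K d alpha (set_type U : choiceType)
  (fun W => val W) K_compact K_hausdorff alpha_wf alpha_countable).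
- by exists (SigSub (mem_set UV)).
- by move=> W; have [] := Uopen _ (set_valP W).
- move=> W W' y Wy W'y; apply: val_inj; apply: Utriv.
  + exact: set_valP.
  + exact: set_valP.
  + by exists y.
- by move=> W; apply: UA; exact: set_valP.
Qed.
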